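(* Let $0<s<n$ and $0<f\in L^1(\mathbb{R}^n)$. Then $$\|I_{s}(f)\|_{L^{\frac{n}{n-s},\infty}(\mathbb{R}^n)}\geq \gamma_s v_{n}^{\frac{n-s}{n}}\|f\|_{L^1(\mathbb{R}^n)}.$$ Moreover, equality holds when $f(x)=\left(\frac{a}{b+|x-x_0|^2}\right)^{\frac{n+s}{2}}$, where $a,b>0$ and $x_0\in\mathbb{R}^n$.
   Context: For $0<s<n$, the Riesz potential of $f$ is $$I_{s}(f)(x)=\gamma_s\int_{\mathbb{R}^n}\frac{f(x-y)}{|y|^{n-s}}\,dy,\qquad \gamma_s=2^{-s}\pi^{-\frac{n}{2}}\frac{\Gamma(\frac{n-s}{2})}{\Gamma(\frac{s}{2})}.$$ The weak quasinorm is $$\|g\|_{L^{\frac{n}{n-s},\infty}(\mathbb{R}^n)}=\sup_{\lambda>0}\lambda\,|\{x\in\mathbb{R}^n:|g(x)|>\lambda\}|^{\frac{n-s}{n}},$$ where $|E|$ denotes Lebesgue measure of $E$. The number $v_n$ is the volume of the unit ball in $\mathbb{R}^n$. *)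

(* Defs.v *)
From HB Require Import structures.
From mathcomp Require Import all_boot all_order all_algebra.
From mathcomp Require Import all_classical all_reals all_analysis.

Set Implicit Arguments.
Unset Strict Implicit.
Unset Printing Implicit Defensive.

Import Order.TTheory GRing.Theory Num.Theory.
Import numFieldNormedType.Exports.

Local Open Scope classical_set_scope.
Local Open Scope ring_scope.

(* 'rV[R]_n carries the product sigma-algebra, as n.-tuple R does in the
   library. *)
Section measurable_rV.
Variables (R : realType) (n : nat).

Definition coord_rV (i : 'I_n) (x : 'rV[R]_n) : measurableTypeR R := x ord0 i.

Let rV_set0 : g_sigma_preimage coord_rV set0.
Proof. exact: sigma_algebra0. Qed.

Let rV_setC A : g_sigma_preimage coord_rV A -> g_sigma_preimage coord_rV (~` A).
Proof. exact: sigma_algebraC. Qed.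

Let rV_bigcup (F : (set 'rV[R]_n)^nat) :
  (forall i, g_sigma_preimage coord_rV (F i)) ->
  g_sigma_preimage coord_rV (\bigcup_i F i).
Proof. exact: sigma_algebra_bigcup. Qed.

HB.instance Definition _ := @isMeasurable.Build
  (measure_tuple_display (R.-ocitv.-measurable).-sigma) 'rV[R]_n
  (g_sigma_preimage coord_rV) rV_set0 rV_setC rV_bigcup.

Lemma measurable_coord_rV i : measurable_fun [set: 'rV[R]_n] (coord_rV i).
Proof.
move=> _ Y mY; rewrite setTI; apply: sub_sigma_algebra => /=.
rewrite -bigcup_seq/=; exists i => /=; first by rewrite mem_index_enum.
by exists Y => //; rewrite setTI.
Qed.

Lemma measurable_fun_rVP d (T : measurableType d) (f : T -> 'rV[R]_n) :
  measurable_fun [set: T] f <->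
  forall i, measurable_fun [set: T] (coord_rV i \o f).
Proof.
split=> [mf i|mf]; first exact: measurableT_comp (measurable_coord_rV i) mf.
suff pS : preimage_set_system [set: T] f (g_sigma_preimage coord_rV)
    `<=` measurable.
  by move=> _ A mA; apply: pS; exists A.
rewrite -g_sigma_preimage_comp.
apply: smallest_sub; first exact: sigma_algebra_measurable.
rewrite -bigcup_seq; apply: bigcup_sub => i _ A [B mB <-].
exact: mf.
Qed.

End measurable_rV.

(* n-fold product of the one-dimensional Lebesgue measure, transported along
   R * R^n ~ R^(n + 1). *)
Section product_lebesgue.
Variable R : realType.

Definition cons_rV n (p : measurableTypeR R * 'rV[R]_n) : 'rV[R]_n.+1 :=
  row_mx (\row_(_ < 1) p.1) p.2.

Lemma measurable_cons_rV n :
  measurable_fun [set: measurableTypeR R * 'rV[R]_n] (@cons_rV n).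
Proof.
apply/measurable_fun_rVP => i; rewrite /comp /coord_rV /cons_rV.
have [j ->|j ->] := @split_ordP 1 n i.
- rewrite (_ : (fun _ => _) = fst) ?measurable_fst//.
  by apply/funext => p; apply: etrans (@row_mxEl R 1 1 n _ _ _ _) _; rewrite mxE.
- rewrite (_ : (fun _ => _) = coord_rV j \o snd).
    exact: measurableT_comp (measurable_coord_rV j) measurable_snd.
  by apply/funext => p; exact: (@row_mxEr R 1 1 n).
Qed.

Definition uncons_rV n (x : 'rV[R]_n.+1) : measurableTypeR R * 'rV[R]_n :=
  (x ord0 ord0, \row_i x ord0 (lift ord0 i)).

Lemma cons_rVK n : cancel (@cons_rV n) (@uncons_rV n).
Proof.
move=> [a x]; congr pair.
  transitivity (cons_rV (a, x) ord0 (@lshift 1 n ord0)).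
    by congr (cons_rV _ _ _); exact: val_inj.
  by apply: etrans (@row_mxEl R 1 1 n _ _ _ _) _; rewrite mxE.
apply/rowP => i; rewrite mxE.
transitivity (cons_rV (a, x) ord0 (@rshift 1 n i)).
  by congr (cons_rV _ _ _); exact: val_inj.
exact: (@row_mxEr R 1 1 n).
Qed.

Lemma measurable_uncons_rV n : measurable_fun [set: 'rV[R]_n.+1] (@uncons_rV n).
Proof.
apply/measurable_fun_pairP; split.
  exact: (@measurable_coord_rV R n.+1 ord0).
apply/measurable_fun_rVP => i.
rewrite (_ : _ \o _ = coord_rV (lift ord0 i)); first exact: measurable_coord_rV.
by apply/funext => x /=; rewrite /coord_rV mxE.
Qed.

Section step.
Variables (n : nat) (m : {sigma_finite_measure set 'rV[R]_n -> \bar R}).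

Definition cons_measure : set 'rV[R]_n.+1 -> \bar R :=
  pushforward (@lebesgue_measure R \x m)%E (@cons_rV n).

Let cons_measure0 : cons_measure set0 = 0%E.
Proof. by rewrite /cons_measure /pushforward preimage_set0 measure0. Qed.

Let cons_measure_ge0 A : (0 <= cons_measure A)%E.
Proof. by rewrite /cons_measure /pushforward; exact: measure_ge0. Qed.

Let cons_measure_sigma_additive : semi_sigma_additive cons_measure.
Proof.
move=> F mF tF mUF; rewrite /cons_measure /pushforward preimage_bigcup.
apply: measure_semi_sigma_additive.
- by move=> k; rewrite -[X in measurable X]setTI; exact: measurable_cons_rV.
- apply/trivIsetP => /= i j _ _ ij; rewrite -preimage_setI.
  by move/trivIsetP : tF => /(_ _ _ _ _ ij) ->//; rewrite preimage_set0.
- rewrite -preimage_bigcup -[X in measurable X]setTI.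
  exact: measurable_cons_rV.
Qed.

HB.instance Definition _ := isMeasure.Build _ _ _ cons_measure
  cons_measure0 cons_measure_ge0 cons_measure_sigma_additive.

Let cons_measure_sigma_finite : sigma_finite setT cons_measure.
Proof.
have /sigma_finiteP[F [TF ndF Foo]] := sigma_finiteT (@lebesgue_measure R).
have /sigma_finiteP[G [TG ndG Goo]] := sigma_finiteT m.
exists (fun k => @uncons_rV n @^-1` (F k `*` G k)).
  rewrite -preimage_bigcup -[LHS](preimage_setT (@uncons_rV n)); congr (_ @^-1` _).
  rewrite -setXTT TF TG predeqE => -[x y]; split.
    move=> [/= [k _ Fkx] [l _ Gly]]; exists (maxn k l) => //; split.
    - by move: x Fkx; exact/subsetPset/ndF/leq_maxl.
    - by move: y Gly; exact/subsetPset/ndG/leq_maxr.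
  by move=> [k _ []/= ? ?]; split; exists k.
move=> k; have [mF Fk] := Foo k; have [mG Gk] := Goo k; split.
  by rewrite -[X in measurable X]setTI; apply: measurable_uncons_rV => //;
    exact: measurableX.
rewrite /cons_measure /pushforward -comp_preimage.
rewrite (_ : _ @^-1` _ = F k `*` G k); last first.
  apply/seteqP; split=> p;
    by rewrite /preimage /mkset (_ : (_ \o _) p = p)//; exact: cons_rVK.
by rewrite product_measure1E// lte_mul_pinfty// ge0_fin_numE.
Qed.

HB.instance Definition _ := Measure_isSigmaFinite.Build _ _ _ cons_measure
  cons_measure_sigma_finite.

End step.

Let dirac0_sigma_finite : sigma_finite setT (@dirac _ 'rV[R]_0 0 R).
Proof. by apply: fin_num_fun_sigma_finite; [rewrite measure0|exact: fin_num_measure]. Qed.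

Fixpoint product_lebesgue n : {sigma_finite_measure set 'rV[R]_n -> \bar R} :=
  match n with
  | 0 => @dirac _ 'rV[R]_0 0 R
  | n'.+1 => cons_measure (product_lebesgue n')
  end.

End product_lebesgue.

(* The measurable sets of lebesgue_rV are the Lebesgue measurable sets, i.e.
   the Caratheodory sets of the outer measure generated by the product. *)
Definition lebesgue_rV (R : realType) (n : nat) :
    set (caratheodory_type (product_lebesgue R n)^*%mu) -> \bar R :=
  @completed_measure_extension _ _ R (product_lebesgue R n).
HB.instance Definition _ (R : realType) (n : nat) :=
  Measure.on (@lebesgue_rV R n).
Arguments lebesgue_rV : clear implicits.

Section riesz.
Variable R : realType.
Implicit Types (n : nat) (s p : R).

(* The norm provided by the library on 'rV[R]_n is the sup norm. *)
Definition enorm n (x : 'rV[R]_n) : R := Num.sqrt (\sum_i x ord0 i ^+ 2).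

Definition Gamma (z : R) : R :=
  \int[lebesgue_measure]_(t in `]0, +oo[) (t `^ (z - 1) * expR (- t)).

Definition riesz_const n s : R :=
  2 `^ (- s) * pi `^ (- (n%:R / 2)) * (Gamma ((n%:R - s) / 2) / Gamma (s / 2)).

(* Extended-real valued: the integral may be infinite on a null set. *)
Definition riesz_potential n s (f : 'rV[R]_n -> R) (x : 'rV[R]_n) : \bar R :=
  ((riesz_const n s)%:E *
   \int[lebesgue_rV R n]_y (f (x - y) / enorm y `^ (n%:R - s))%:E)%E.

Definition weak_Lnorm n p (g : 'rV[R]_n -> \bar R) : \bar R :=
  ereal_sup [set (l%:E * lebesgue_rV R n [set x | (l%:E < `|g x|)%E] `^ p^-1)%E
            | l in [set l : R | 0 < l]].

Definition unit_ball_volume n : \bar R :=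
  lebesgue_rV R n [set x : 'rV[R]_n | enorm x < 1].

End riesz.

(* Main.v *)
Require Import Defs.
From mathcomp Require Import all_boot all_order all_algebra.
From mathcomp Require Import all_classical all_reals all_analysis.
From mathcomp Require Import measurable_realfun ring lra.

(** Write I f (x) for the integral of f (x - y) / |y|^(n - s) over y, so that the
Riesz potential is gamma_s I f, and let v be the volume of the unit ball.

The lower bound only looks at infinity, where I f (x) is asymptotic to
|x|^(s - n) times the mass of f. Let m_r be the mass of f in the ball of radius
r about 0. If |x - y| < r then |y| < |x| + r, hence
I f (x) >= m_r (|x| + r)^(s - n) ([riesz_potential_ge]). So the set where
gamma_s I f exceeds gamma_s m_r rho^(s - n) contains the ball of radius rho - r,
and evaluating the quasinorm at that level gives at least
gamma_s m_r ((rho - r) / rho)^(n - s) v^((n - s) / n)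
([weak_Lnorm_truncated_ge]). Letting the ratio tend to 1 and then r tend to
infinity gives the bound.

For the bubble f (y) = (b + |y|^2)^(- (n + s) / 2) the asymptotic value is an
upper bound at every point, because of the identity
  I f (x) = m (b + |x|^2)^(- (n - s) / 2), with m the mass of f.
The superlevel sets of gamma_s I f thus lie in the balls on which
gamma_s m |x|^(s - n) exceeds the level, and the quasinorm is at most
gamma_s m v^((n - s) / n) ([weak_Lnorm_le_inverse_power]). Only the inequality
I f (x) <= m (b + |x|^2)^(- (n - s) / 2) is proved
([integral_riesz_bubble_le]). With p = (n + s) / 2 and q = (n - s) / 2, it comes
from writing the product of the two kernels as one Feynman integral,
  Gamma(p) Gamma(q) K1^-p K2^-q
    = int_0^oo v^(q - 1) Gamma(p + q) (K1 + v K2)^-(p + q) dv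
([integral_beta]), taken at K1 = b + |x - y|^2 and K2 = |y|^2, where p + q = n.
By Tonelli the y-integral is done first: a power of a quadratic polynomial is
a superposition of Gaussians, so its integral is explicit
([integral_quadratic_powR]), and at the exponent n it is a constant times
(b + v (b + |x|^2))^(- n / 2). What remains is again a Feynman integral, now
with exponents s / 2 and q. Gaussians apart, every one-dimensional integral on
the way is the Gamma integral with a rescaled variable.

The measurable sets are the Lebesgue ones while Tonelli's theorem is applied to
the Borel product, so two facts link the completed measure to the product:
they integrate Borel functions alike ([ge0_integral_lebesgue_rV]), and the
invariance of the product under y |-> x - y passes to the outer measure, hence
to the Lebesgue measurable sets ([measurable_reflect],
[ge0_integral_reflect]). *)

Set Implicit Arguments.
Unset Strict Implicit.
Unset Printing Implicit Defensive.

Import Order.TTheory GRing.Theory Num.Theory.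
Import numFieldNormedType.Exports.
Local Open Scope classical_set_scope.
Local Open Scope ring_scope.

(** * Lebesgue measure under affine maps and reflections *)

Section affine_change_of_variables.
Context {R : realType}.
Local Notation mu1 := (@lebesgue_measure R).
Local Open Scope ereal_scope.

Lemma measurable_affine1 (x c : R) :
  measurable_fun [set: measurableTypeR R]
    (fun y : measurableTypeR R => (x + c * y)%R : measurableTypeR R).
Proof. by apply: measurable_funD => //; exact: measurable_funM. Qed.

(** Lebesgue measure is determined by its values on half-open intervals; a
negative slope turns ]a, b] into a half-open interval of the other kind, which
has the same length. *)
Lemma lebesgue_measure_affine (x c : R) (A : set (measurableTypeR R)) : c != 0%R ->
  measurable A ->
  mu1 A = `|c|%:E * mu1 ((fun y => x + c * y)%R @^-1` A).
Proof.
move=> c0 mA.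
pose T := (fun y : measurableTypeR R => (x + c * y)%R : measurableTypeR R).
have cge0 : (0 <= `|c|)%R by [].
pose m := mscale (NngNum cge0) (pushforward mu1 T).
rewrite (_ : `|c|%:E * _ = m (measurable_affine1 x c) A)//.
apply: lebesgue_measure_unique => //= _ [[a b]] /= ab <-.
rewrite /m /mscale /= /pushforward.
have [cp|cn|/eqP] := ltgtP c 0%R; last by rewrite (negbTE c0).
- rewrite (_ : T @^-1` _ = [set` `[((b - x) / c), ((a - x) / c)[%R])%R; last first.
    apply/seteqP; split => y /=; rewrite /T !in_itv/= => /andP[h1 h2]; apply/andP; split.
    + by rewrite ler_ndivrMr//; lra.
    + by rewrite ltr_ndivlMr//; lra.
    + by move: h2; rewrite ltr_ndivlMr//; lra.
    + by move: h1; rewrite ler_ndivrMr//; lra.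
  rewrite !lebesgue_measure_itv/= !lte_fin ltr_nM2r ?invr_lt0// ltrD2r.
  case: ifPn => // _; last by rewrite mule0.
  rewrite ltr0_norm// -!EFinB -EFinM; congr EFin; field; lra.
- rewrite (_ : T @^-1` _ = [set` `]((a - x) / c), ((b - x) / c)]%R])%R; last first.
    apply/seteqP; split => y /=; rewrite /T !in_itv/= => /andP[h1 h2]; apply/andP; split.
    + by rewrite ltr_pdivrMr//; lra.
    + by rewrite ler_pdivlMr//; lra.
    + by move: h1; rewrite ltr_pdivrMr//; lra.
    + by move: h2; rewrite ler_pdivlMr//; lra.
  rewrite !lebesgue_measure_itv/= !lte_fin ltr_pM2r ?invr_gt0// ltrD2r.
  case: ifPn => // _; last by rewrite mule0.
  rewrite gtr0_norm// -!EFinB -EFinM; congr EFin; field; lra.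
Qed.

End affine_change_of_variables.

Section affine_rV.
Context {R : realType}.
Local Open Scope ereal_scope.
Local Notation mu := (product_lebesgue R).

Lemma measurable_affine n (x : 'rV[R]_n) (c : R) :
  measurable_fun [set: 'rV[R]_n] (fun y : 'rV[R]_n => x + c *: y : 'rV[R]_n)%R.
Proof.
apply/measurable_fun_rVP => i.
rewrite (_ : _ \o _ = fun y => x ord0 i + c * coord_rV i y)%R; last first.
  by apply/funext => y; rewrite /coord_rV /= !mxE.
apply: measurable_funD => //; apply: measurable_funM => //.
exact: measurable_coord_rV.
Qed.

(** An affine homothety acts coordinatewise, so it maps boxes to boxes and the
claim follows by induction on the dimension from the uniqueness of product
measures. Translations, reflections and dilations of balls are all instances. *)
Lemma product_lebesgue_affine n (x : 'rV[R]_n) (c : R) (A : set 'rV[R]_n) : c != 0%R ->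
  measurable A ->
  mu n A = (`|c| ^+ n)%:E * mu n ((fun y => x + c *: y)%R @^-1` A).
Proof.
move=> c0; elim: n x A => [|n IH] x A mA.
  rewrite expr0 mul1e /= /dirac /= !indicE; congr (_%:E); congr (_%:R); congr nat_of_bool.
  by apply/idP/idP; rewrite !inE/= (_ : (x + c *: 0)%R = 0%R)//;
    apply/rowP => -[].
rewrite /= /cons_measure /pushforward.
(* T is the homothety read through the splitting R^(n+1) ~ R * R^n. *)
pose x' := (\row_i x ord0 (lift ord0 i))%R.
pose T := (fun p : measurableTypeR R * 'rV[R]_n =>
  ((x ord0 ord0 + c * p.1)%R : measurableTypeR R, (x' + c *: p.2)%R : 'rV[R]_n)).
have mT : measurable_fun setT T.
  apply: measurable_fun_pair => /=.
    by apply: measurableT_comp (measurable_affine1 _ _) measurable_fst.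
  by apply: measurableT_comp (measurable_affine _ _) measurable_snd.
have cge0 : (0 <= `|c| ^+ n.+1)%R by rewrite exprn_ge0.
pose m := mscale (NngNum cge0) (pushforward (@lebesgue_measure R \x mu n) T).
have mAc : measurable (@cons_rV R n @^-1` A).
  by rewrite -[X in measurable X]setTI; exact: measurable_cons_rV.
have mE X : m mT X = (`|c| ^+ n.+1)%:E * (@lebesgue_measure R \x mu n) (T @^-1` X).
  by [].
transitivity (m mT (@cons_rV R n @^-1` A)).
  apply: product_measure_unique => // B C mB mC.
  have TBC : T @^-1` (B `*` C) =
    ((fun y => x ord0 ord0 + c * y)%R @^-1` B) `*` ((fun y => x' + c *: y)%R @^-1` C).
    by apply/seteqP; split.
  apply: etrans (mE _) _; rewrite TBC product_measure1E//; last 2 first.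
  - by rewrite -[X in measurable X]setTI; exact: measurable_affine1.
  - by rewrite -[X in measurable X]setTI; exact: measurable_affine.
  by rewrite exprS EFinM muleACA -lebesgue_measure_affine// -IH.
have AT : T @^-1` (@cons_rV R n @^-1` A) =
    @cons_rV R n @^-1` ((fun y => x + c *: y)%R @^-1` A).
  apply/funext => -[a v]; rewrite /preimage/=; congr (A _); apply/rowP => i.
  rewrite /cons_rV /T/= !mxE; case: splitP => j ij /=; rewrite !mxE/=.
    have i0 : i = ord0 by apply/val_inj; rewrite /= ij ord1.
    by rewrite i0.
  by congr (x _ _ + _)%R; apply: val_inj.
by apply: etrans (mE _) _; rewrite AT.
Qed.

End affine_rV.

Section scaling_integrals.
Context {R : realType}.
Local Notation mu1 := (@lebesgue_measure R).
Local Open Scope ereal_scope.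

Lemma ge0_integral_scale (c : R) (h : R -> \bar R) : (0 < c)%R ->
  measurable_fun [set: measurableTypeR R] h -> (forall t, 0 <= h t) ->
  \int[mu1]_t h t = c%:E * \int[mu1]_t h (c * t)%R.
Proof.
move=> c0 mh h0.
pose T := (fun y : measurableTypeR R => (0 + c * y)%R : measurableTypeR R).
have mT : measurable_fun setT T := measurable_affine1 0 c.
pose m := mscale (NngNum (ltW c0)) (pushforward mu1 T).
rewrite (eq_measure_integral (m mT)); last first.
  move=> A mA _; apply: etrans (lebesgue_measure_affine 0 (lt0r_neq0 c0) mA) _.
  by rewrite gtr0_norm.
rewrite ge0_integral_mscale//=; congr (_ * _).
rewrite ge0_integral_pushforward//; apply: eq_integral => t _.
by rewrite /T /= add0r.
Qed.

End scaling_integrals.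

Section lebesgue_rV_theory.
Context {R : realType} {n : nat}.
Local Open Scope ereal_scope.
Local Notation mu := (product_lebesgue R n).
Local Notation leb := (lebesgue_rV R n).
Local Notation rVleb := (caratheodory_type (product_lebesgue R n)^*%mu).

Lemma lebesgue_rVE (A : set 'rV[R]_n) : measurable A -> leb A = mu A.
Proof. exact: measurable_mu_extE. Qed.

Lemma measurable_rVleb (A : set 'rV[R]_n) :
  measurable A -> measurable (A : set rVleb).
Proof. exact: caratheodory_measurable_mu_ext. Qed.

Lemma le_lebesgue_rV (A B : set 'rV[R]_n) : A `<=` B -> leb A <= leb B.
Proof. exact: le_mu_ext. Qed.

Lemma measurable_fun_rVleb d (T : measurableType d) (g : 'rV[R]_n -> T) :
  measurable_fun [set: 'rV[R]_n] g -> measurable_fun [set: rVleb] g.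
Proof.
move=> mg _ Y mY; apply: measurable_rVleb.
exact: mg.
Qed.

(** The identity is measurable from the Lebesgue to the Borel sigma-algebra, and
the image of the completed measure under it is the product measure. *)
Lemma ge0_integral_lebesgue_rV (g : 'rV[R]_n -> \bar R) :
  measurable_fun [set: 'rV[R]_n] g -> (forall y, 0 <= g y) ->
  \int[leb]_y g y = \int[mu]_y g y.
Proof.
move=> mg g0.
have mid : measurable_fun [set: rVleb] (id : rVleb -> 'rV[R]_n).
  exact: measurable_fun_rVleb.
transitivity (\int[pushforward leb (id : rVleb -> 'rV[R]_n)]_y g y).
  by rewrite ge0_integral_pushforward.
apply: eq_measure_integral => A mA _.
exact: lebesgue_rVE.
Qed.

Local Notation reflect_at x := (fun y : 'rV[R]_n => x - y)%R.

(** A reflection transports countable covers by Borel sets without changing the sum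
of their measures, and it is its own inverse, so one inequality is enough. *)
Lemma lebesgue_rV_reflect (x : 'rV[R]_n) (A : set 'rV[R]_n) :
  leb (reflect_at x @^-1` A) = leb A.
Proof.
suff le_reflect B : leb (reflect_at x @^-1` B) <= leb B.
  apply/eqP; rewrite eq_le le_reflect/=.
  rewrite -[X in _ X <= _](_ : reflect_at x @^-1` (reflect_at x @^-1` A) = A)//.
  by apply/funext => y; rewrite /preimage/= subKr.
apply: ereal_inf_le_tmp => _ [F [mF BF] <-].
have reflectE : reflect_at x = (fun y => x + (-1) *: y)%R.
  by apply/funext => y; rewrite scaleN1r.
exists (fun k => reflect_at x @^-1` F k).
  split=> [k|y /BF[k _ Fk]]; last by exists k.
  by rewrite reflectE -[X in measurable X]setTI; exact: measurable_affine.
apply: eq_eseriesr => k _.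
have N10 : (- 1 != 0 :> R)%R by rewrite oppr_eq0 oner_eq0.
apply/esym; apply: etrans (product_lebesgue_affine x N10 (mF k)) _.
by rewrite normrN normr1 expr1n mul1e reflectE.
Qed.

(** Caratheodory's criterion is stated in terms of the outer measure alone, which
the reflection preserves. *)
Lemma measurable_reflect (x : 'rV[R]_n) :
  measurable_fun [set: rVleb] (reflect_at x : rVleb -> rVleb).
Proof.
move=> _ A mA; rewrite setTI.
suff : caratheodory_measurable (mu^*)%mu (reflect_at x @^-1` A) by [].
have {}mA : caratheodory_measurable (mu^*)%mu A by [].
move=> X; change (leb X = leb (X `&` reflect_at x @^-1` A) + leb (X `&` ~` (reflect_at x @^-1` A))).
rewrite -(lebesgue_rV_reflect x X) -(lebesgue_rV_reflect x (X `&` reflect_at x @^-1` A)).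
rewrite -(lebesgue_rV_reflect x (X `&` ~` (reflect_at x @^-1` A))).
have AE : reflect_at x @^-1` (reflect_at x @^-1` A) = A.
  by apply/funext => y; rewrite /preimage/= subKr.
rewrite !preimage_setI -!preimage_setC AE.
exact: (mA (reflect_at x @^-1` X)).
Qed.

Lemma ge0_integral_reflect (x : 'rV[R]_n) (g : 'rV[R]_n -> \bar R) :
  measurable_fun [set: rVleb] g -> (forall y, 0 <= g y) ->
  \int[leb]_y g (x - y)%R = \int[leb]_y g y.
Proof.
move=> mg g0.
have mreflect := @measurable_reflect x.
transitivity (\int[pushforward leb (reflect_at x : rVleb -> rVleb)]_y g y).
  by rewrite ge0_integral_pushforward.
apply: eq_measure_integral => A mA _.
exact: lebesgue_rV_reflect.
Qed.

End lebesgue_rV_theory.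

(** * The Gamma integral *)

Section gamma_integral.
Context {R : realType}.
Local Notation mu1 := (@lebesgue_measure R).
Implicit Types (z c t : R).

(** The density t^(z-1) of the Gamma integral, extended by 0 to the whole line:
Tonelli's theorem then applies on R * R without carrying a domain along. *)
Definition powR_pos z t : R := if 0 < t then t `^ (z - 1) else 0.

Lemma powR_pos_ge0 z t : 0 <= powR_pos z t.
Proof. by rewrite /powR_pos; case: ifP => // _; exact: powR_ge0. Qed.

Lemma measurable_powR_pos z : measurable_fun [set: R] (powR_pos z).
Proof.
apply: measurable_fun_ifT.
- exact: measurable_fun_ltr.
- exact: measurable_powR.
- exact: measurable_cst.
Qed.

Lemma powR_pos_scale z c t : 0 < c -> powR_pos z (c * t) = c `^ (z - 1) * powR_pos z t.
Proof.
move=> c0; rewrite /powR_pos pmulr_rgt0//; case: ifPn => t0; last by rewrite mulr0.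
by rewrite powRM// ltW.
Qed.

Local Notation gexp z c t := (powR_pos z t * expR (- (c * t))).

Lemma measurable_powR_pos_exp z c : measurable_fun [set: R] (fun t => gexp z c t).
Proof.
apply: measurable_funM; first exact: measurable_powR_pos.
apply: (measurableT_comp (@measurable_expR R)).
by apply: measurable_funN; exact: measurable_funM.
Qed.

Lemma powR_pos_exp_ge0 z c t : 0 <= gexp z c t.
Proof. by rewrite mulr_ge0 ?powR_pos_ge0 ?expR_ge0. Qed.

(** The integrand is unbounded at 0 when z < 1: the fundamental theorem of
calculus is applied on [1 / (k + 2), 1], where the integral is at most 1 / z, and
the bound passes to the increasing union. *)
Lemma integral_powR_near0 z : 0 < z ->
  (\int[mu1]_(t in `]0%R, 1%R]) (t `^ (z - 1))%:E <= (z^-1)%:E)%E.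
Proof.
move=> z0.
pose F k := `[(k.+2%:R^-1 : R), 1]%classic.
have k01 k : 0 < (k.+2%:R : R)^-1 < 1.
  by rewrite invr_gt0 ltr0n/= invf_lt1 ?ltr0n// ltr1n.
have FE : `]0, 1]%classic = \bigcup_k F k.
  apply/seteqP; split => t /=.
    rewrite in_itv/= => /andP[t0 t1].
    exists (Num.truncn t^-1) => //=; rewrite /F/= in_itv/= t1 andbT.
    rewrite invf_ple ?posrE ?ltr0n//.
    by rewrite (le_trans (ltW (truncnS_gt _)))// ler_nat.
  move=> [k _]; rewrite /F/= !in_itv/= => /andP[kt ->]; rewrite andbT.
  by rewrite (lt_le_trans _ kt)//; case/andP: (k01 k).
have ndF : nondecreasing_seq F.
  apply/nondecreasing_seqP => k; rewrite subsetEset => t; rewrite /F/= !in_itv/=.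
  move=> /andP[kt ->]; rewrite andbT (le_trans _ kt)// lef_pV2 ?posrE ?ltr0n//.
  by rewrite ler_nat.
have mf : measurable_fun setT (fun t : R => (t `^ (z - 1))%:E).
  by apply/measurable_EFinP; exact: measurable_powR.
have /cvg_lim <- // : (\int[mu1]_(t in F i) (t `^ (z - 1))%:E @[i --> \oo] -->
    \int[mu1]_(t in `]0%R, 1%R]) (t `^ (z - 1))%:E)%E.
  rewrite FE; apply: ge0_nondecreasing_set_cvg_integral => //.
  - by move=> k; exact: measurable_itv.
  - by move=> k; exact: measurable_funTS.
  - by move=> k t _; rewrite lee_fin powR_ge0.
apply: lime_le.
  apply: ereal_nondecreasing_is_cvgn.
  apply: ge0_nondecreasing_set_nondecreasing_integral => //.
  - by move=> k; exact: measurable_itv.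
  - by move=> k; exact: measurable_funTS.
  - by move=> k t _; rewrite lee_fin powR_ge0.
apply: nearW => k; have /andP[k0 k1] := k01 k.
pose G t := z^-1 * t `^ z.
have dG t : 0 < t -> derivable G t 1 /\ G^`()%classic t = t `^ (z - 1).
  move=> t0.
  have tin : t \in `]0, +oo[ by rewrite in_itv/= t0.
  have dp : derivable (fun x : R => x `^ z) t 1 by exact: (@derivable_powR R 1 z t tin).
  split; first exact: derivableM.
  by rewrite derive1Ml// powR_derive1// mulrA mulVf ?mul1r// gt_eqF.
have cG t : 0 < t -> {for t, continuous G}.
  move=> t0; apply: differentiable_continuous; apply/derivable1_diffP.
  by have [] := dG _ t0.
rewrite (@continuous_FTC2 _ _ G)//.
- rewrite -EFinB lee_fin /G powR1 mulr1 gerBl.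
  by rewrite mulr_ge0 ?powR_ge0// invr_ge0 ltW.
- apply: continuous_in_subspaceT => t; rewrite inE/= in_itv/= => /andP[kt _].
  have t0 : 0 < t by exact: lt_le_trans kt.
  apply: differentiable_continuous; apply/derivable1_diffP.
  by apply: (@derivable_powR R 1 (z - 1)); rewrite in_itv/= t0.
- split.
  + by move=> t; rewrite in_itv/= => /andP[kt _]; have [] := dG _ (lt_trans k0 kt).
  + by apply: cvg_at_right_filter; exact: cG.
  + by apply: cvg_at_left_filter; exact: cG.
- move=> t; rewrite in_itv/= => /andP[kt _].
  by have [_ ->] := dG _ (lt_trans k0 kt).
Qed.

(** One term of the exponential series, of degree above |z|, dominates the power. *)
Lemma powR_le_expR z : exists2 C, 0 <= C & forall t, 1 <= t -> t `^ (z - 1) <= C * expR (2^-1 * t).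
Proof.
pose m := (Num.truncn `|z|).+1.
exists (2 ^+ m * m`!%:R); first by rewrite mulr_ge0 ?exprn_ge0.
move=> t t1; have t0 : 0 <= t by exact: le_trans t1.
apply: (@le_trans _ _ (t ^+ m)).
  rewrite -powR_mulrn// ler_powR//.
  have := truncnS_gt `|z|; rewrite -/m => zm.
  by have := ler_norm z; lra.
have h : (2^-1 * t) ^+ m / m`!%:R <= expR (2^-1 * t).
  apply: le_trans (@expR_ge1Dxn _ (2^-1 * t) m.-1 _); first by rewrite lerDr.
  by rewrite mulr_ge0.
have -> : t ^+ m = 2 ^+ m * m`!%:R * ((2^-1 * t) ^+ m / m`!%:R).
  rewrite exprMn exprVn; field.
  by rewrite pnatr_eq0 -lt0n fact_gt0 expf_neq0.
by rewrite ler_wpM2l// mulr_ge0 ?exprn_ge0.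
Qed.

(** Near 0 the integrand is below t^(z-1); on [1, +oo[ it is below a multiple of
the exponential density of rate 1/2. *)
Lemma integral_powR_pos_exp1_lty z : 0 < z ->
  (\int[mu1]_t (gexp z 1 t)%:E < +oo)%E.
Proof.
move=> z0; have [C C0 CP] := powR_le_expR z.
pose f1 := (fun t : R => t `^ (z - 1)) \_ `]0, 1].
pose f2 := exponential_pdf (2^-1 : R).
have mp : measurable_fun setT (fun t : R => t `^ (z - 1)) by exact: measurable_powR.
have mf1 : measurable_fun setT f1.
  by apply/(measurable_restrictT _ _).1 => //; exact: measurable_funTS.
have f10 t : 0 <= f1 t by apply: restrict_ge0 => x _; exact: powR_ge0.
have f20 t : 0 <= f2 t by apply: exponential_pdf_ge0.
have mf2 := measurable_exponential_pdf (2^-1 : R).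
apply: (@le_lt_trans _ _ (\int[mu1]_t ((f1 t)%:E + (2 * C)%:E * (f2 t)%:E))%E).
  apply: ge0_le_integral => //.
  - by move=> t _; rewrite lee_fin powR_pos_exp_ge0.
  - by apply/measurable_EFinP; exact: measurable_powR_pos_exp.
  - apply: emeasurable_funD; first exact/measurable_EFinP.
    by apply: measurable_funeM; exact/measurable_EFinP.
  - move=> t _; rewrite -EFinM -EFinD lee_fin /powR_pos mul1r.
    case: ifPn => t0; last first.
      by rewrite mul0r addr_ge0// !mulr_ge0.
    have [t1|t1] := leP t 1.
      apply: ler_wpDr; first by rewrite !mulr_ge0.
      rewrite /f1 patchE mem_set/= ?in_itv/= ?t0//.
      by rewrite ler_piMr ?powR_ge0// expR_le1; lra.
    apply: ler_wpDl => //.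
    apply: (@le_trans _ _ (C * expR (2^-1 * t) * expR (- t))).
      by rewrite ler_wpM2r ?expR_ge0// CP// ltW.
    rewrite /f2 exponential_pdfE ?(ltW t0)// -[leLHS]mulrA -expRD.
    rewrite (_ : 2^-1 * t - t = - 2^-1 * t); last by field.
    by rewrite le_eqVlt (_ : _ * _ = 2 * C * (2^-1 * expR (- 2^-1 * t))) ?eqxx//; field.
rewrite ge0_integralD//; last 4 first.
- by move=> t _; rewrite lee_fin.
- exact/measurable_EFinP.
- by move=> t _; rewrite -EFinM lee_fin !mulr_ge0.
- by apply: measurable_funeM; exact/measurable_EFinP.
apply: lte_add_pinfty.
  rewrite (_ : (fun _ => _) = (fun t : R => (t `^ (z - 1))%:E) \_ `]0, 1]); last first.
    by rewrite /f1 restrict_EFin.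
  by rewrite -integral_mkcond (le_lt_trans (integral_powR_near0 z0))// ltry.
apply: (@le_lt_trans _ _ ((2 * C)%:E * \int[mu1]_t (f2 t)%:E)%E).
  rewrite le_eqVlt; apply/orP; left; apply/eqP.
  apply: ge0_integralZl_EFin => //.
  - by move=> t _; rewrite lee_fin.
  - exact/measurable_EFinP.
  - by rewrite mulr_ge0.
by rewrite /= integral_exponential_pdf// mule1 ltry.
Qed.

(** On ]1, 2] the integrand is exp ((z - 1) ln t - t) with 0 <= ln t < t <= 2. *)
Lemma integral_powR_pos_exp1_gt0 z : (0 < \int[mu1]_t (gexp z 1 t)%:E)%E.
Proof.
pose k := expR (- (2 * (`|z - 1| + 1))).
apply: (@lt_le_trans _ _ (\int[mu1]_(t in `]1%R, 2%R]) k%:E)%E).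
  rewrite integral_cst//= lebesgue_measure_itv/= lte_fin ltr1n -EFinB -EFinM lte_fin.
  by rewrite mulr_gt0 ?expR_gt0//; lra.
apply: (@le_trans _ _ (\int[mu1]_(t in `]1%R, 2%R]) (gexp z 1 t)%:E)%E).
  apply: ge0_le_integral => //.
  - by move=> t _; rewrite lee_fin expR_ge0.
  - by apply/measurable_funTS/measurable_EFinP; exact: measurable_powR_pos_exp.
  - move=> t /=; rewrite in_itv/= => /andP[t1 t2].
    have t0 : 0 < t by lra.
    rewrite lee_fin /powR_pos t0 mul1r /powR gt_eqF// -expRD ler_expR.
    have lnt0 : 0 <= ln t by rewrite ln_ge0// ltW.
    have lnt : ln t < t by exact: ln_sublinear.
    have : - `|z - 1| * ln t <= (z - 1) * ln t.
      by rewrite ler_wpM2r// lerNl ler_normr lexx orbT.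
    have : `|z - 1| * ln t <= `|z - 1| * 2 by rewrite ler_wpM2l//; lra.
    by rewrite mulNr; lra.
apply: ge0_subset_integral => //.
- by apply/measurable_EFinP; exact: measurable_powR_pos_exp.
- by move=> t _; rewrite lee_fin powR_pos_exp_ge0.
Qed.

Lemma integral_powR_pos_exp1 z : 0 < z ->
  (\int[mu1]_t (gexp z 1 t)%:E = (Gamma z)%:E)%E.
Proof.
move=> z0; rewrite /Gamma /Rintegral integral_mkcond.
rewrite [in RHS](_ : _ \_ _ = (fun t => (gexp z 1 t)%:E)).
  rewrite fineK// ge0_fin_numE ?integral_powR_pos_exp1_lty//.
  by rewrite ltW// integral_powR_pos_exp1_gt0.
apply/funext => t; rewrite /powR_pos patchE mul1r.
rewrite (_ : (t \in _) = (0 < t)); first by case: ifP; rewrite ?mul0r.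
by apply/idP/idP; rewrite inE/= in_itv/= andbT.
Qed.

Lemma Gamma_ge0 z : 0 <= Gamma z.
Proof. by apply: Rintegral_ge0 => t _; rewrite mulr_ge0 ?powR_ge0 ?expR_ge0. Qed.

Lemma Gamma_gt0 z : 0 < z -> 0 < Gamma z.
Proof.
by move=> z0; rewrite -lte_fin -integral_powR_pos_exp1// integral_powR_pos_exp1_gt0.
Qed.

(** The rescaled Gamma integral writes a power of c as a superposition of
exponentials, which is how powers are integrated everywhere below. *)
Lemma integral_powR_pos_exp z c : 0 < z -> 0 < c ->
  (\int[mu1]_t (powR_pos z t * expR (- (c * t)))%:E = (c `^ (- z) * Gamma z)%:E)%E.
Proof.
move=> z0 c0.
have cz0 : 0 <= c `^ z by exact: powR_ge0.
have h : ((Gamma z)%:E = (c `^ z)%:E * \int[mu1]_t (gexp z c t)%:E)%E.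
  rewrite -integral_powR_pos_exp1// (ge0_integral_scale c0)//; last 2 first.
  - by apply/measurable_EFinP; exact: measurable_powR_pos_exp.
  - by move=> t; rewrite lee_fin powR_pos_exp_ge0.
  under eq_integral => t _.
    rewrite mul1r powR_pos_scale// -mulrA EFinM; over.
  rewrite ge0_integralZl//; last 3 first.
  - by apply/measurable_EFinP; exact: measurable_powR_pos_exp.
  - by move=> t _; rewrite lee_fin powR_pos_exp_ge0.
  - by rewrite lee_fin powR_ge0.
  by rewrite muleA -EFinM mulr_powRB1// ltW.
rewrite EFinM h muleA -EFinM -powRD ?addNr ?powRr0 ?mul1e//.
by rewrite (gt_eqF c0) implybT.
Qed.

End gamma_integral.

Local Opaque Gamma.

(** * Gaussian integrals on R^n *)

Section euclidean_norm.
Context {R : realType} {n : nat}.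
Implicit Types (x y : 'rV[R]_n).

Lemma enorm_ge0 x : 0 <= enorm x.
Proof. exact: sqrtr_ge0. Qed.

Lemma sqr_enorm x : enorm x ^+ 2 = \sum_i x ord0 i ^+ 2.
Proof. by rewrite sqr_sqrtr// sumr_ge0// => i _; rewrite sqr_ge0. Qed.

Lemma measurable_enorm : measurable_fun [set: 'rV[R]_n] (@enorm R n).
Proof.
apply: (measurableT_comp (f := @Num.sqrt R)).
  by apply: continuous_measurable_fun; exact: sqrt_continuous.
apply: measurable_sum => i; apply: measurable_funX.
exact: measurable_coord_rV.
Qed.

Lemma measurable_enormB x :
  measurable_fun [set: 'rV[R]_n] (fun y => enorm (x - y)).
Proof.
rewrite (_ : (fun _ => _) = @enorm R n \o (fun y => x + (-1) *: y)).
  by apply: measurableT_comp; [exact: measurable_enorm|exact: measurable_affine].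
by apply/funext => y /=; rewrite scaleN1r.
Qed.

End euclidean_norm.

Section gaussian.
Context {R : realType}.
Local Notation mu1 := (@lebesgue_measure R).

(** This is the total mass of the normal law of mean m and variance 1 / (2c). *)
Lemma integral_gauss_center (c m : R) : 0 < c ->
  (\int[mu1]_a (expR (- (c * (a - m) ^+ 2)))%:E = (Num.sqrt (pi / c))%:E)%E.
Proof.
move=> c0; pose s := Num.sqrt (2 * c)^-1.
have s2 : s ^+ 2 = (2 * c)^-1 by rewrite sqr_sqrtr// invr_ge0; lra.
have s0 : s != 0 by rewrite gt_eqF// sqrtr_gt0 invr_gt0; lra.
have peak : normal_peak s = (Num.sqrt (pi / c))^-1.
  by rewrite /normal_peak s2; congr (Num.sqrt _)^-1; rewrite -mulr_natr; field; lra.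
have pc0 : 0 < Num.sqrt (pi / c) by rewrite sqrtr_gt0 divr_gt0// pi_gt0.
rewrite -[RHS]mule1 -(integral_normal_pdf m s) -ge0_integralZl//; last 2 first.
- by apply/measurable_EFinP; exact: measurable_normal_pdf.
- by move=> a _; rewrite lee_fin normal_pdf_ge0.
apply: eq_integral => a _; rewrite -EFinM; congr EFin.
rewrite /normal_pdf (negbTE s0) peak mulVKf ?gt_eqF// /normal_fun s2.
by congr expR; rewrite -mulr_natr; field; lra.
Qed.

(** Tonelli's theorem, iterated along the inductive construction of the product
measure. *)
Lemma integral_prod_rV n (g : 'I_n -> R -> R) (G : 'I_n -> R) :
  (forall i, measurable_fun [set: R] (g i)) -> (forall i a, 0 <= g i a) ->
  (forall i, \int[mu1]_a (g i a)%:E = (G i)%:E)%E ->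
  (\int[product_lebesgue R n]_y (\prod_i g i (y ord0 i))%:E = (\prod_i G i)%:E)%E.
Proof.
elim: n g G => [|n IH] g G mg g0 gG.
  rewrite /= integral_dirac//; last first.
    by under eq_fun do rewrite big_ord0; exact: measurable_cst.
  by rewrite !big_ord0 diracT mule1.
have mprod m (h : 'I_m -> R -> R) : (forall i, measurable_fun [set: R] (h i)) ->
    measurable_fun [set: 'rV[R]_m] (fun y : 'rV[R]_m => (\prod_i h i (y ord0 i))%:E).
  move=> mh; apply/measurable_EFinP; apply: measurable_prod => i _.
  exact: (measurableT_comp (mh i) (measurable_coord_rV i)).
rewrite /= ge0_integral_pushforward//; last 3 first.
- exact: measurable_cons_rV.
- exact: mprod.
- by move=> y _; rewrite lee_fin prodr_ge0.
pose F (p : measurableTypeR R * 'rV[R]_n) :=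
  (g ord0 p.1 * \prod_(i < n) g (lift ord0 i) (p.2 ord0 i))%:E.
have FE p : ((\prod_(i < n.+1) g i (cons_rV p ord0 i))%:E = F p)%E.
  have c0 : cons_rV p ord0 ord0 = p.1 by have := congr1 fst (cons_rVK p).
  have cS i : cons_rV p ord0 (lift ord0 i) = p.2 ord0 i.
    have := congr1 (fun q : measurableTypeR R * 'rV[R]_n => q.2 ord0 i) (cons_rVK p).
    by rewrite /= mxE.
  by rewrite big_ord_recl c0; under eq_bigr do rewrite cS.
rewrite preimage_setT; under eq_integral do rewrite /= FE.
rewrite fubini_tonelli1//; last 2 first.
- apply/measurable_EFinP; apply: measurable_funM.
    exact: (measurableT_comp (mg ord0) measurable_fst).
  apply: measurable_prod => i _.
  exact: (measurableT_comp (mg _) (measurableT_comp (measurable_coord_rV i) measurable_snd)).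
- by move=> p; rewrite lee_fin mulr_ge0// prodr_ge0.
rewrite /fubini_F /F /=.
under eq_integral => a _.
  under eq_integral do rewrite EFinM.
  rewrite ge0_integralZl//; last 3 first.
  - by apply: (mprod n (fun i => g (lift ord0 i))) => i; exact: mg.
  - by move=> y _; rewrite lee_fin prodr_ge0.
  - by rewrite lee_fin.
  rewrite (IH (fun i => g (lift ord0 i)) (fun i => G (lift ord0 i)))//; over.
rewrite ge0_integralZr//; last 3 first.
- by apply/measurable_EFinP; exact: mg.
- by move=> a _; rewrite lee_fin.
- rewrite lee_fin prodr_ge0// => i _; rewrite -lee_fin -gG.
  by apply: integral_ge0 => a _; rewrite lee_fin.
by rewrite gG -EFinM big_ord_recl.
Qed.

(** The integrand factors over the coordinates; in each of them one completes the
square, t (x - a)^2 + u a^2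
= (t + u) (a - t x / (t + u))^2 + t u / (t + u) x^2. *)
Lemma integral_gauss_rV n (x : 'rV[R]_n) (t u : R) : 0 < t + u ->
  (\int[product_lebesgue R n]_y
     (expR (- (t * enorm (x - y) ^+ 2 + u * enorm y ^+ 2)))%:E =
   ((pi / (t + u)) `^ (n%:R / 2) * expR (- (t * u / (t + u) * enorm x ^+ 2)))%:E)%E.
Proof.
move=> tu0.
have gE (y : 'rV[R]_n) : expR (- (t * enorm (x - y) ^+ 2 + u * enorm y ^+ 2)) =
    \prod_i expR (- (t * (x ord0 i - y ord0 i) ^+ 2 + u * y ord0 i ^+ 2)).
  rewrite -expR_sum; congr expR; rewrite !sqr_enorm !mulr_sumr -big_split/= -sumrN.
  by apply: eq_bigr => i _; rewrite !mxE.
under eq_integral do rewrite gE.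
rewrite (integral_prod_rV (g := fun i a => expR (- (t * (x ord0 i - a) ^+ 2 + u * a ^+ 2)))
  (G := fun i => Num.sqrt (pi / (t + u)) * expR (- (t * u / (t + u) * x ord0 i ^+ 2))))//.
- rewrite big_split/= prodr_const card_ord -expR_sum; congr (_ * expR _)%:E.
    rewrite -powR12_sqrt ?divr_ge0 ?pi_ge0 ?ltW//.
    by rewrite -powR_mulrn ?powR_ge0// -powRrM (mulrC 2^-1).
  by rewrite sqr_enorm mulr_sumr sumrN.
- move=> i; apply: measurableT_comp => //; apply: measurable_funN.
  apply: measurable_funD; apply: measurable_funM => //; apply: measurable_funX => //.
  exact: measurable_funB.
- move=> i; rewrite mulrC EFinM.
  rewrite -(integral_gauss_center (t * x ord0 i / (t + u)) tu0) -ge0_integralZl//; last first.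
  - apply/measurable_EFinP; apply: measurableT_comp => //; apply: measurable_funN.
    apply: measurable_funM => //; apply: measurable_funX => //.
    exact: measurable_funB.
  apply: eq_integral => a _; rewrite -EFinM -expRD; congr (expR _)%:E.
  by field; lra.
Qed.

End gaussian.

(** * Beta integrals and powers of quadratic polynomials *)

Section beta_and_riesz_kernels.
Context {R : realType}.
Local Notation mu1 := (@lebesgue_measure R).

Lemma powR_pos_le0 (z t : R) : t <= 0 -> powR_pos z t = 0.
Proof. by move=> t0; rewrite /powR_pos ltNge t0. Qed.

Lemma powR_pos_shift (z r t : R) : 0 < t ->
  powR_pos (z + r) t * t `^ (- r) = powR_pos z t.
Proof.
move=> t0; rewrite /powR_pos t0 -powRD; last by rewrite (gt_eqF t0) implybT.
by congr (_ `^ _); ring.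
Qed.

Lemma integralM_powR_pos_exp (k z c : R) : 0 <= k -> 0 < z -> 0 < c ->
  (\int[mu1]_t (k * (powR_pos z t * expR (- (c * t))))%:E =
   (k * (c `^ (- z) * Gamma z))%:E)%E.
Proof.
move=> k0 z0 c0; under eq_integral do rewrite EFinM.
rewrite ge0_integralZl_EFin//.
- by rewrite integral_powR_pos_exp.
- by move=> t _; rewrite lee_fin powR_pos_exp_ge0.
- by apply/measurable_EFinP; exact: measurable_powR_pos_exp.
Qed.

(** Feynman's formula. Expanding (K1 + v K2)^-(a + b) as a superposition of
exponentials exp (- (K1 + v K2) t) and integrating over v first gives a Gamma
integral of parameter b, which leaves a power t^-b and hence a Gamma integral of
parameter a. At K1 = K2 = 1 this is Euler's formula for the Beta function. *)
Lemma integral_beta (a b K1 K2 : R) : 0 < a -> 0 < b -> 0 < K1 -> 0 < K2 ->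
  (\int[mu1]_v (powR_pos b v * (Gamma (a + b) * (K1 + v * K2) `^ (- (a + b))))%:E =
   (Gamma a * Gamma b * K1 `^ (- a) * K2 `^ (- b))%:E)%E.
Proof.
move=> a0 b0 K10 K20; have ab0 : 0 < a + b by exact: addr_gt0.
pose f (p : measurableTypeR R * measurableTypeR R) : \bar R :=
  (powR_pos b p.1 * (powR_pos (a + b) p.2 * expR (- ((K1 + p.1 * K2) * p.2))))%:E.
transitivity (\int[mu1]_v \int[mu1]_t f (v, t))%E.
  apply: eq_integral => v _; have [v0|v0] := leP v 0.
    rewrite /f/= powR_pos_le0// mul0r; under eq_integral do rewrite mul0r.
    by rewrite integral0.
  rewrite /f /= integralM_powR_pos_exp ?powR_pos_ge0//.
    by rewrite (mulrC (Gamma _)).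
  by rewrite addr_gt0// mulr_gt0.
rewrite fubini_tonelli; last 2 first.
- apply/measurable_EFinP; apply: measurable_funM.
    exact: (measurableT_comp (@measurable_powR_pos R b) measurable_fst).
  apply: measurable_funM.
    exact: (measurableT_comp (@measurable_powR_pos R _) measurable_snd).
  apply: (measurableT_comp (@measurable_expR R)); apply: measurable_funN.
  apply: measurable_funM; last exact: measurable_snd.
  by apply: measurable_funD => //; apply: measurable_funM => //; exact: measurable_fst.
- by move=> p; rewrite lee_fin !mulr_ge0 ?powR_pos_ge0 ?expR_ge0.
transitivity (\int[mu1]_t ((Gamma b * K2 `^ (- b)) *
    (powR_pos a t * expR (- (K1 * t))))%:E)%E.
  apply: eq_integral => t _; have [t0|t0] := leP t 0.
    under eq_integral do rewrite /f/= (powR_pos_le0 _ t0) mul0r mulr0.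
    by rewrite integral0 powR_pos_le0// mul0r mulr0.
  under eq_integral => v _.
    rewrite /f/= (_ : powR_pos b v * _ = (powR_pos (a + b) t * expR (- (K1 * t))) *
      (powR_pos b v * expR (- (t * K2 * v)))); last first.
      rewrite (_ : - ((K1 + v * K2) * t) = - (K1 * t) + - (t * K2 * v)); last by ring.
      by rewrite expRD; ring.
    over.
  rewrite integralM_powR_pos_exp ?mulr_gt0//; last by rewrite mulr_ge0 ?powR_pos_ge0 ?expR_ge0.
  rewrite powRM ?(ltW t0) ?(ltW K20)// -(powR_pos_shift a b t0).
  by congr EFin; ring.
rewrite integralM_powR_pos_exp//; last by rewrite mulr_ge0 ?powR_ge0// ltW ?Gamma_gt0.
by congr EFin; ring.
Qed.

Variable n : nat.
Local Notation mu := (product_lebesgue R n).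

(** The power is a superposition of exponentials in t of the quadratic polynomial;
for fixed t the y-integral is Gaussian and contributes t^(- n / 2), so what is
left is a Gamma integral of parameter p - n / 2. *)
Lemma integral_quadratic_powR (x : 'rV[R]_n) (b v p : R) :
  0 < b -> 0 <= v -> n%:R / 2 < p ->
  (\int[mu]_y (Gamma p *
      (b + enorm (x - y) ^+ 2 + v * enorm y ^+ 2) `^ (- p))%:E =
   (pi `^ (n%:R / 2) * Gamma (p - n%:R / 2) * (1 + v) `^ (- (n%:R / 2)) *
    (b + v / (1 + v) * enorm x ^+ 2) `^ (- (p - n%:R / 2)))%:E)%E.
Proof.
move=> b0 v0 np; have v10 : 0 < 1 + v by lra.
have n0 : 0 <= (n%:R : R) by [].
have p0 : 0 < p by lra.
have pn0 : 0 < p - n%:R / 2 by lra.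
pose K (y : 'rV[R]_n) := b + enorm (x - y) ^+ 2 + v * enorm y ^+ 2.
have K0 y : 0 < K y.
  by rewrite /K -addrA ltr_pwDl// addr_ge0 ?sqr_ge0// mulr_ge0 ?sqr_ge0.
pose f (q : 'rV[R]_n * measurableTypeR R) : \bar R :=
  (powR_pos p q.2 * expR (- (K q.1 * q.2)))%:E.
transitivity (\int[mu]_y \int[mu1]_t f (y, t))%E.
  by apply: eq_integral => y _; rewrite /f/= integral_powR_pos_exp// mulrC.
rewrite fubini_tonelli; last 2 first.
- apply/measurable_EFinP; apply: measurable_funM.
    exact: (measurableT_comp (@measurable_powR_pos R p) measurable_snd).
  apply: (measurableT_comp (@measurable_expR R)); apply: measurable_funN.
  apply: measurable_funM; last exact: measurable_snd.
  apply: (measurableT_comp (f := K)); last exact: measurable_fst.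
  apply: measurable_funD; first apply: measurable_funD => //.
    by apply: measurable_funX; exact: measurable_enormB.
  apply: measurable_funM => //; apply: measurable_funX; exact: measurable_enorm.
- by move=> q; rewrite lee_fin powR_pos_exp_ge0.
pose c := b + v / (1 + v) * enorm x ^+ 2.
transitivity (\int[mu1]_t ((pi `^ (n%:R / 2) * (1 + v) `^ (- (n%:R / 2))) *
    (powR_pos (p - n%:R / 2) t * expR (- (c * t))))%:E)%E.
  apply: eq_integral => t _; have [t0|t0] := leP t 0.
    under eq_integral do rewrite /f/= (powR_pos_le0 _ t0) mul0r.
    by rewrite integral0 powR_pos_le0// mul0r mulr0.
  have ttv0 : 0 < t + t * v by rewrite ltr_pwDl// mulr_ge0// ltW.
  under eq_integral => y _.
    rewrite /f/= (_ : - (K y * t) = - (b * t) +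
        - (t * enorm (x - y) ^+ 2 + t * v * enorm y ^+ 2)); last by rewrite /K; ring.
    rewrite expRD mulrA EFinM; over.
  rewrite ge0_integralZl_EFin; last 4 first.
  - exact: measurableT.
  - by move=> y _; rewrite lee_fin expR_ge0.
  - apply/measurable_EFinP; apply: (measurableT_comp (@measurable_expR R)).
    apply: measurable_funN; apply: measurable_funD; apply: measurable_funM => //.
      by apply: measurable_funX; exact: measurable_enormB.
    by apply: measurable_funX; exact: measurable_enorm.
  - by rewrite mulr_ge0 ?powR_pos_ge0 ?expR_ge0.
  rewrite integral_gauss_rV// -EFinM; congr EFin.
  rewrite (_ : pi / (t + t * v) = pi * (t^-1 * (1 + v)^-1)); last by field; lra.
  rewrite powRM ?pi_ge0 ?mulr_ge0 ?invr_ge0// ?(ltW t0) ?(ltW v10)//.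
  rewrite powRM ?invr_ge0// ?(ltW t0) ?(ltW v10)//.
  rewrite -(powR_inv1 (ltW t0)) -(powR_inv1 (ltW v10)) -!powRrM !mulN1r.
  rewrite -(powR_pos_shift (p - n%:R / 2) (n%:R / 2) t0) subrK.
  rewrite (_ : - (c * t) = - (b * t) + - (t * (t * v) / (t + t * v) * enorm x ^+ 2)).
    by rewrite expRD; ring.
  by rewrite /c; field; lra.
rewrite integralM_powR_pos_exp//.
- by congr EFin; rewrite /c; ring.
- by rewrite mulr_ge0 ?powR_ge0.
- by rewrite /c ltr_pwDl// mulr_ge0 ?sqr_ge0// divr_ge0// ltW.
Qed.

End beta_and_riesz_kernels.

(** * The Riesz integral of a bubble *)

(** The integral of (b + |y|^2)^(- (n + s) / 2) over R^n, see [integral_bubble]. *)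
Definition bubble_mass (R : realType) (n : nat) (s b : R) : R :=
  pi `^ (n%:R / 2) * Gamma (s / 2) / Gamma ((n%:R + s) / 2) * b `^ (- (s / 2)).

Section bubble.
Context {R : realType} {n : nat}.
Local Notation mu1 := (@lebesgue_measure R).
Local Notation mu := (product_lebesgue R n).

Lemma bubble_mass_ge0 (s b : R) : 0 < s -> 0 <= bubble_mass n s b.
Proof.
move=> s0; have n0 : 0 <= (n%:R : R) by [].
have G1 : 0 < Gamma (s / 2) by apply: Gamma_gt0; lra.
have G2 : 0 < Gamma ((n%:R + s) / 2) by apply: Gamma_gt0; lra.
rewrite /bubble_mass mulr_ge0 ?powR_ge0// divr_ge0 ?(ltW G2)//.
by rewrite mulr_ge0 ?powR_ge0 ?(ltW G1).
Qed.

(** [integral_quadratic_powR] without the term in |y|^2, that is at v = 0. *)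
Lemma integral_bubble (s b : R) (x : 'rV[R]_n) : 0 < s -> 0 < b ->
  (\int[mu]_y ((b + enorm (x - y) ^+ 2) `^ (- ((n%:R + s) / 2)))%:E =
   (bubble_mass n s b)%:E)%E.
Proof.
move=> s0 b0; have n0 : 0 <= (n%:R : R) by [].
set p := (n%:R + s) / 2.
have pn : p - n%:R / 2 = s / 2 by rewrite /p; lra.
have np : n%:R / 2 < p by rewrite /p; lra.
have pE : p = (n%:R + s) / 2 by [].
clearbody p; have p0 : 0 < p by lra.
have Gp : 0 < Gamma p by exact: Gamma_gt0.
have -> : bubble_mass n s b = (Gamma p)^-1 * (pi `^ (n%:R / 2) * Gamma (p - n%:R / 2) *
    (1 + 0) `^ (- (n%:R / 2)) *
    (b + 0 / (1 + 0) * enorm x ^+ 2) `^ (- (p - n%:R / 2))).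
  rewrite /bubble_mass addr0 powR1 !mul0r addr0 mulr1.
  by rewrite pn -pE; ring.
rewrite EFinM -integral_quadratic_powR//.
rewrite -ge0_integralZl_EFin.
- apply: eq_integral => y _; rewrite -EFinM mul0r addr0 mulKf//.
  by rewrite gt_eqF.
- exact: measurableT.
- by move=> y _; rewrite lee_fin mulr_ge0 ?powR_ge0// ltW.
- apply/measurable_EFinP; apply: measurable_funM => //.
  apply: (measurableT_comp (@measurable_powR R _)).
  apply: measurable_funD; first apply: measurable_funD => //.
    by apply: measurable_funX; exact: measurable_enormB.
  by apply: measurable_funM => //; apply: measurable_funX; exact: measurable_enorm.
- by rewrite invr_ge0 ltW.
Qed.

(** The integrand of Feynman's formula for the kernels (b + |x - y|^2)^-p and
(|y|^2)^-q with p + q = n, as a function of y and of the parameter v. *)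
Definition feynman_integrand (q b : R) (x : 'rV[R]_n)
    (w : 'rV[R]_n * measurableTypeR R) : R :=
  powR_pos q w.2 * (Gamma n%:R *
    (b + enorm (x - w.1) ^+ 2 + w.2 * enorm w.1 ^+ 2) `^ (- n%:R)).

Lemma measurable_feynman_integrand q b x :
  measurable_fun setT (feynman_integrand q b x).
Proof.
apply: measurable_funM.
  exact: (measurableT_comp (@measurable_powR_pos R q) measurable_snd).
apply: measurable_funM => //; apply: (measurableT_comp (@measurable_powR R _)).
apply: measurable_funD; first apply: measurable_funD => //.
  apply: measurable_funX.
  exact: (measurableT_comp (measurable_enormB x) measurable_fst).
apply: measurable_funM; first exact: measurable_snd.
apply: measurable_funX.
exact: (measurableT_comp measurable_enorm measurable_fst).
Qed.

Lemma feynman_integrand_ge0 q b x w : 0 <= feynman_integrand q b x w.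
Proof. by rewrite mulr_ge0 ?powR_pos_ge0// mulr_ge0 ?Gamma_ge0 ?powR_ge0. Qed.

Definition riesz_bubble (p q b : R) (x y : 'rV[R]_n) : R :=
  (b + enorm (x - y) ^+ 2) `^ (- p) / enorm y `^ q.

Lemma measurable_riesz_bubble p q b x :
  measurable_fun [set: 'rV[R]_n] (riesz_bubble p q b x).
Proof.
apply: measurable_funM.
  apply: (measurableT_comp (@measurable_powR R _)); apply: measurable_funD => //.
  by apply: measurable_funX; exact: measurable_enormB.
under eq_fun do rewrite -powRN.
by apply: (measurableT_comp (@measurable_powR R _)); exact: measurable_enorm.
Qed.

Lemma riesz_bubble_ge0 p q b x y : 0 <= riesz_bubble p q b x y.
Proof. by rewrite divr_ge0 ?powR_ge0. Qed.

(** Feynman's formula makes this an equality for y <> 0. At y = 0 the left-hand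
side is 0, as the quotient by 0 is 0. *)
Lemma riesz_bubble_le_feynman (p q b : R) (x y : 'rV[R]_n) :
  0 < p -> 0 < q -> p + q = n%:R -> 0 < b ->
  ((Gamma p * Gamma q)%:E * (riesz_bubble p (2 * q) b x y)%:E <=
   \int[mu1]_v (feynman_integrand q b x (y, v))%:E)%E.
Proof.
move=> p0 q0 pq b0; rewrite /riesz_bubble.
have [y0|y0] := eqVneq (enorm y) 0.
  rewrite y0 powR0 ?mulf_neq0 ?gt_eqF// invr0 mulr0 mule0.
  by apply: integral_ge0 => v _; rewrite lee_fin feynman_integrand_ge0.
have {}y0 : 0 < enorm y by rewrite lt_neqAle eq_sym y0 enorm_ge0.
have Kb0 : 0 < b + enorm (x - y) ^+ 2 by rewrite ltr_pwDl// sqr_ge0.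
have -> : (enorm y `^ (2 * q))^-1 = (enorm y ^+ 2) `^ (- q).
  by rewrite -powRN -[enorm y ^+ 2]powR_mulrn ?(ltW y0)// -powRrM mulrN.
rewrite /feynman_integrand/= -pq integral_beta// ?exprn_gt0//.
by rewrite -EFinM lee_fin mulrA.
Qed.

(** At exponent n the two powers produced by [integral_quadratic_powR] have the
same exponent - n / 2, so they merge into a power of a base affine in v. *)
Lemma integral_feynman_rV (p q b v : R) (x : 'rV[R]_n) :
  p + q = n%:R / 2 -> 0 < p -> 0 < q -> 0 < b -> 0 < v ->
  (\int[mu]_y (feynman_integrand q b x (y, v))%:E =
   (pi `^ (n%:R / 2) * (powR_pos q v *
     (Gamma (p + q) * (b + v * (b + enorm x ^+ 2)) `^ (- (p + q)))))%:E)%E.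
Proof.
move=> pq p0 q0 b0 v0; under eq_integral do rewrite /feynman_integrand/= EFinM.
have n2 : n%:R - n%:R / 2 = n%:R / 2 :> R by lra.
have n2n : n%:R / 2 < n%:R :> R by lra.
have v1 : 0 < 1 + v by lra.
have E : b + v * (b + enorm x ^+ 2) = (1 + v) * (b + v / (1 + v) * enorm x ^+ 2).
  by field; rewrite gt_eqF.
have B0 : 0 <= b + v / (1 + v) * enorm x ^+ 2.
  by rewrite addr_ge0 ?(ltW b0)// mulr_ge0 ?sqr_ge0// divr_ge0 ?(ltW v0) ?(ltW v1).
rewrite ge0_integralZl_EFin.
- rewrite /= integral_quadratic_powR ?(ltW v0)//.
  rewrite -EFinM; congr EFin; rewrite pq n2 E (powRM _ (ltW v1) B0).
  by ring.
- exact: measurableT.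
- by move=> y _; rewrite lee_fin mulr_ge0 ?Gamma_ge0 ?powR_ge0.
- apply/measurable_EFinP; apply: measurable_funM => //.
  apply: (measurableT_comp (@measurable_powR R _)).
  apply: measurable_funD; first apply: measurable_funD => //.
    by apply: measurable_funX; exact: measurable_enormB.
  by apply: measurable_funM => //; apply: measurable_funX; exact: measurable_enorm.
- exact: powR_pos_ge0.
Qed.

(** After the y-integration the integrand is again of Feynman's form, with
K1 = b and K2 = b + |x|^2. *)
Lemma integral_feynman (p q b : R) (x : 'rV[R]_n) :
  p + q = n%:R / 2 -> 0 < p -> 0 < q -> 0 < b ->
  (\int[mu1]_v \int[mu]_y (feynman_integrand q b x (y, v))%:E =
   (pi `^ (n%:R / 2) * (Gamma p * Gamma q * b `^ (- p) *
      (b + enorm x ^+ 2) `^ (- q)))%:E)%E.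
Proof.
move=> pq p0 q0 b0.
transitivity (\int[mu1]_v ((pi `^ (n%:R / 2))%:E * (powR_pos q v *
    (Gamma (p + q) * (b + v * (b + enorm x ^+ 2)) `^ (- (p + q))))%:E))%E.
  apply: eq_integral => v _; have [v0|v0] := leP v 0.
    under eq_integral do rewrite /feynman_integrand/= powR_pos_le0// mul0r.
    by rewrite powR_pos_le0// integral0 mul0r mule0.
  by rewrite (integral_feynman_rV _ pq).
rewrite ge0_integralZl_EFin.
- by rewrite integral_beta// ltr_pwDl// sqr_ge0.
- exact: measurableT.
- move=> v _; rewrite lee_fin mulr_ge0 ?powR_pos_ge0//.
  by rewrite mulr_ge0 ?Gamma_ge0 ?powR_ge0.
- apply/measurable_EFinP; apply: measurable_funM; first exact: measurable_powR_pos.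
  apply: measurable_funM => //; apply: (measurableT_comp (@measurable_powR R _)).
  by apply: measurable_funD => //; exact: measurable_funM.
- exact: powR_ge0.
Qed.

(** The exponents s / 2 and (n - s) / 2 left by the y-integration add up to n / 2,
and the Gamma factor of (n - s) / 2 cancels: the constant is the mass of the
bubble. *)
Lemma integral_riesz_bubble_le (s b : R) (x : 'rV[R]_n) :
  0 < s -> s < n%:R -> 0 < b ->
  (\int[mu]_y (riesz_bubble ((n%:R + s) / 2) (n%:R - s) b x y)%:E <=
   (bubble_mass n s b * (b + enorm x ^+ 2) `^ (- ((n%:R - s) / 2)))%:E)%E.
Proof.
move=> s0 sn b0.
have [p pE] : exists p, p = (n%:R + s) / 2 by eexists.
have [q qE] : exists q, q = (n%:R - s) / 2 by eexists.
have p0 : 0 < p by rewrite pE; lra.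
have q0 : 0 < q by rewrite qE; lra.
have pq : p + q = n%:R by rewrite pE qE; lra.
have n2 : s / 2 + q = n%:R / 2 by rewrite qE; lra.
have s20 : 0 < s / 2 by lra.
have nsE : n%:R - s = 2 * q by rewrite qE; lra.
have Gp : 0 < Gamma p by exact: Gamma_gt0.
have GG0 : 0 < Gamma p * Gamma q by rewrite mulr_gt0// Gamma_gt0.
rewrite -pE -qE nsE -(@lee_pmul2l _ (Gamma p * Gamma q)%:E) ?lte_fin//.
rewrite -EFinM /bubble_mass -pE.
have -> : Gamma p * Gamma q * (pi `^ (n%:R / 2) * Gamma (s / 2) / Gamma p *
    b `^ (- (s / 2)) * (b + enorm x ^+ 2) `^ (- q)) =
    pi `^ (n%:R / 2) * (Gamma (s / 2) * Gamma q * b `^ (- (s / 2)) *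
      (b + enorm x ^+ 2) `^ (- q)).
  by field; rewrite gt_eqF.
rewrite -(integral_feynman x n2)//.
rewrite -ge0_integralZl_EFin.
- rewrite -(fubini_tonelli (fun w => (feynman_integrand q b x w)%:E)).
  + apply: ge0_le_integral.
    * exact: measurableT.
    * by move=> y _; rewrite -EFinM lee_fin mulr_ge0 ?(ltW GG0) ?riesz_bubble_ge0.
    * by apply: measurable_funeM; apply/measurable_EFinP; exact: measurable_riesz_bubble.
    * apply: (measurable_fun_fubini_tonelli_F (fun w => (feynman_integrand q b x w)%:E)).
        by apply/measurable_EFinP; exact: measurable_feynman_integrand.
      by move=> w; rewrite lee_fin feynman_integrand_ge0.
    * by move=> y _; exact: riesz_bubble_le_feynman.
  + by apply/measurable_EFinP; exact: measurable_feynman_integrand.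
  + by move=> w; rewrite lee_fin feynman_integrand_ge0.
- exact: measurableT.
- by move=> y _; rewrite lee_fin riesz_bubble_ge0.
- by apply/measurable_EFinP; exact: measurable_riesz_bubble.
- exact: ltW.
Qed.

End bubble.

(** * Euclidean balls *)

Section balls.
Context {R : realType} {n : nat}.
Implicit Types (x y z : 'rV[R]_n).
Local Notation mu := (product_lebesgue R n).
Local Notation leb := (lebesgue_rV R n).

Lemma enormZ (c : R) x : enorm (c *: x) = `|c| * enorm x.
Proof.
rewrite /enorm -sqrtr_sqr -sqrtrM ?sqr_ge0// mulr_sumr; congr Num.sqrt.
by apply: eq_bigr => i _; rewrite mxE exprMn.
Qed.

Lemma enormN x : enorm (- x) = enorm x.
Proof. by rewrite -scaleN1r enormZ normrN normr1 mul1r. Qed.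

Lemma enorm_eq0 x : enorm x = 0 -> x = 0.
Proof.
move/(congr1 (fun r => r ^+ 2)); rewrite sqr_enorm expr0n/= => /eqP.
rewrite psumr_eq0 => [/allP x0|i _]; last exact: sqr_ge0.
apply/rowP => i; rewrite mxE; apply/eqP; rewrite -sqrf_eq0.
by apply: x0; rewrite mem_index_enum.
Qed.

(** With p = |x| and q = |y|, the bound
(a - b)^2 <= (1 + q / p) a^2 + (1 + p / q) b^2 on each pair of coordinates sums
to (p + q)^2. *)
Lemma ler_enormB x y : enorm (x - y) <= enorm x + enorm y.
Proof.
have [x0|x0] := eqVneq (enorm x) 0.
  by rewrite (enorm_eq0 x0) sub0r enormN lerDr enorm_ge0.
have [y0|y0] := eqVneq (enorm y) 0.
  by rewrite (enorm_eq0 y0) subr0 lerDl enorm_ge0.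
have {}x0 : 0 < enorm x by rewrite lt_neqAle eq_sym x0 enorm_ge0.
have {}y0 : 0 < enorm y by rewrite lt_neqAle eq_sym y0 enorm_ge0.
set p := enorm x in x0 *; set q := enorm y in y0 *.
rewrite -(@ler_pXn2r _ 2) ?nnegrE ?enorm_ge0 ?addr_ge0 ?(ltW x0) ?(ltW y0)//.
rewrite sqr_enorm.
have -> : (p + q) ^+ 2 = (1 + q / p) * p ^+ 2 + (1 + p / q) * q ^+ 2.
  by field; rewrite !gt_eqF.
rewrite /p /q !sqr_enorm -/p -/q !mulr_sumr -big_split/=; apply: ler_sum => i _.
rewrite !mxE; set a := x _ _; set b := y _ _.
rewrite -subr_ge0 (_ : _ - _ = (q * a + p * b) ^+ 2 / (p * q)).
  by rewrite divr_ge0 ?sqr_ge0// ltW// mulr_gt0.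
by field; rewrite !gt_eqF.
Qed.

Definition eball (x0 : 'rV[R]_n) (r : R) : set 'rV[R]_n :=
  [set z | enorm (z - x0) < r].

Lemma measurable_eball x0 r : measurable (eball x0 r).
Proof.
have mf : measurable_fun [set: 'rV[R]_n] (fun z => enorm (z - x0)).
  rewrite (_ : (fun _ => _) = fun z => enorm (x0 - z)); last first.
    by apply/funext => z; rewrite -enormN opprB.
  exact: measurable_enormB.
rewrite (_ : eball x0 r = setT `&` (fun z => enorm (z - x0)) @^-1` `]-oo, r[%classic).
  by apply: mf => //; exact: measurable_itv.
by rewrite setTI; apply/seteqP; split => z; rewrite /eball/= in_itv.
Qed.

Lemma unit_ball_volumeE : unit_ball_volume R n = leb (eball 0 1).
Proof.
rewrite /unit_ball_volume; congr (leb _).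
by apply/seteqP; split => z; rewrite /eball/= subr0.
Qed.

Lemma lebesgue_eball x0 r : 0 < r ->
  leb (eball x0 r) = ((r ^+ n)%:E * unit_ball_volume R n)%E.
Proof.
move=> r0; rewrite unit_ball_volumeE !lebesgue_rVE; [|exact: measurable_eball..].
rewrite (product_lebesgue_affine x0 (lt0r_neq0 r0) (measurable_eball x0 r)).
rewrite gtr0_norm//; congr (_ * mu _)%E.
apply/seteqP; split => y; rewrite /eball/= addrAC subrr add0r subr0 enormZ gtr0_norm//.
  by rewrite -ltr_pdivlMl// mulVf// gt_eqF.
by rewrite gtr_pMr.
Qed.

Lemma unit_ball_volume_ge0 : (0 <= unit_ball_volume R n)%E.
Proof. exact: measure_ge0. Qed.

(** The indicator of the ball is at most e exp (- |y|^2), whose integral is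
Gaussian. *)
Lemma unit_ball_volume_lty : (unit_ball_volume R n < +oo)%E.
Proof.
rewrite unit_ball_volumeE lebesgue_rVE; last exact: measurable_eball.
rewrite -(setIT (eball 0 1)) -integral_indic//; last exact: measurable_eball.
have mg : measurable_fun [set: 'rV[R]_n]
    (fun y => expR (- (0 * enorm (0 - y) ^+ 2 + 1 * enorm y ^+ 2))).
  apply: (measurableT_comp (@measurable_expR R)); apply: measurable_funN.
  apply: measurable_funD; apply: measurable_funM => //; apply: measurable_funX.
    exact: measurable_enormB.
  exact: measurable_enorm.
apply: (@le_lt_trans _ _ (\int[mu]_y ((expR 1)%:E *
    (expR (- (0 * enorm ((0 : 'rV[R]_n) - y) ^+ 2 + 1 * enorm y ^+ 2)))%:E))%E).
  apply: ge0_le_integral => //.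
  - by apply/measurable_EFinP; apply: measurable_indic; exact: measurable_eball.
  - by apply: measurable_funeM; exact/measurable_EFinP.
  - move=> y _; rewrite -EFinM lee_fin indicE -expRD mul0r add0r mul1r.
    case: (boolP (y \in _)) => [|_]; last exact: expR_ge0.
    rewrite inE /eball/= subr0 => y1.
    rewrite -[leLHS]expR0 ler_expR subr_ge0 expr_le1 ?enorm_ge0//.
    exact: ltW.
rewrite ge0_integralZl_EFin.
- by rewrite integral_gauss_rV ?add0r// -EFinM ltry.
- exact: measurableT.
- by move=> y _; rewrite lee_fin expR_ge0.
- exact/measurable_EFinP.
- exact: expR_ge0.
Qed.

Lemma unit_ball_volume_fin : unit_ball_volume R n \is a fin_num.
Proof. by rewrite ge0_fin_numE ?unit_ball_volume_lty ?unit_ball_volume_ge0. Qed.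

(** A point lies in balls of arbitrarily small radius r, of measure r^n v. *)
Lemma lebesgue_rV_set1 x : (0 < n)%N -> leb [set x] = 0%E.
Proof.
move=> n0; apply/eqP; rewrite eq_le measure_ge0 andbT.
pose V := fine (unit_ball_volume R n).
have V0 : 0 <= V by rewrite fine_ge0// unit_ball_volume_ge0.
apply/lee_addgt0Pr => e e0; rewrite add0e.
pose r := e / (V + 1 + e).
have d0 : 0 < V + 1 + e by lra.
have r0 : 0 < r by rewrite divr_gt0.
have r1 : r <= 1 by rewrite ler_pdivrMr//; lra.
apply: (@le_trans _ _ (leb (eball x r))).
  by apply: le_lebesgue_rV => _ ->; rewrite /eball/= subrr -(scale0r x) enormZ normr0 mul0r.
rewrite lebesgue_eball// -(fineK unit_ball_volume_fin) -/V -EFinM lee_fin.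
apply: (@le_trans _ _ (r * V)).
  by rewrite ler_wpM2r// -[leRHS]expr1 ler_wiXn2l// ltW.
rewrite /r mulrAC ler_pdivrMr// ler_pM2l//; lra.
Qed.

End balls.

(** * Lower bound for the weak quasinorm *)

Section riesz_lower_bound.
Context {R : realType} {n : nat}.
Implicit Types (x y z : 'rV[R]_n).
Local Notation leb := (lebesgue_rV R n).
Local Notation rVleb := (caratheodory_type (product_lebesgue R n)^*%mu).

Lemma measurable_riesz_integrand (s : R) (f : 'rV[R]_n -> R) x :
  measurable_fun [set: rVleb] f ->
  measurable_fun [set: rVleb] (fun y : rVleb => f (x - y) / enorm y `^ (n%:R - s)).
Proof.
move=> mf; apply: measurable_funM.
  exact: (measurableT_comp mf (measurable_reflect x)).
apply: measurable_fun_rVleb; under eq_fun do rewrite -powRN.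
by apply: (measurableT_comp (@measurable_powR R _)); exact: measurable_enorm.
Qed.

(** Where |x - y| < r one has |y| < |x| + r, so the kernel is at least
(|x| + r)^-(n - s) there; the substitution y |-> x - y turns the remaining
integral into the mass of f in the ball about 0. The comparison of integrands
can fail only at y = 0, where the quotient by 0 is 0. *)
Lemma ge0_riesz_integral_ge (s : R) (f : 'rV[R]_n -> R) x (r : R) :
  (0 < n)%N -> s < n%:R -> 0 < r -> measurable_fun [set: rVleb] f -> (forall y, 0 <= f y) ->
  (((enorm x + r) `^ (n%:R - s))^-1%:E * \int[leb]_(y in eball 0 r) (f y)%:E <=
   \int[leb]_y (f (x - y) / enorm y `^ (n%:R - s))%:E)%E.
Proof.
move=> n0 sn r0 mf f0; set c := (_ `^ _)^-1.
have c0 : 0 <= c by rewrite invr_ge0 powR_ge0.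
pose h : rVleb -> R := f \_ (eball 0 r).
have mB : measurable (eball 0 r : set rVleb) by apply: measurable_rVleb; exact: measurable_eball.
have mh : measurable_fun [set: rVleb] h.
  by apply/(measurable_restrictT _ mB).1; exact: measurable_funTS.
have h0 y : 0 <= h y by apply: restrict_ge0 => z _; exact: f0.
rewrite integral_mkcond (_ : _ \_ _ = EFin \o h); last by rewrite /h restrict_EFin.
rewrite -(@ge0_integral_reflect _ _ x (EFin \o h)); last 2 first.
- exact/measurable_EFinP.
- by move=> y; rewrite lee_fin.
have mhr : measurable_fun [set: rVleb] (fun y : rVleb => h (x - y)).
  exact: (measurableT_comp mh (measurable_reflect x)).
rewrite -ge0_integralZl_EFin; last 4 first.
- exact: measurableT.
- by move=> y _; rewrite lee_fin.
- exact/measurable_EFinP.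
- exact: c0.
apply: ae_ge0_le_integral.
- exact: measurableT.
- by move=> y _; rewrite -EFinM lee_fin mulr_ge0.
- by apply: measurable_funeM; exact/measurable_EFinP.
- by move=> y _; rewrite lee_fin divr_ge0 ?powR_ge0.
- by apply/measurable_EFinP; exact: measurable_riesz_integrand.
exists [set 0]; split.
- rewrite (_ : [set 0] = \bigcap_k eball (0 : 'rV[R]_n) k.+1%:R^-1).
    by apply: bigcap_measurable => // k _; apply: measurable_rVleb; exact: measurable_eball.
  apply/seteqP; split => y /=.
    by move=> -> k _; rewrite /eball/= subrr -(scale0r y) enormZ normr0 mul0r invr_gt0.
  move=> yk; apply: enorm_eq0; apply/eqP; rewrite eq_le enorm_ge0 andbT.
  apply/ler_addgt0Pr => e e0; rewrite add0r.
  have := yk (Num.truncn e^-1) I; rewrite /eball/= subr0 => /ltW/le_trans; apply.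
  by rewrite invf_ple ?posrE// ltW// truncnS_gt.
- exact: lebesgue_rV_set1.
move=> y /= yP; apply: contrapT => y0; apply: yP => _.
have {}y0 : 0 < enorm y.
  by rewrite lt_neqAle enorm_ge0 andbT eq_sym; apply/eqP => /enorm_eq0.
rewrite -EFinM lee_fin /h patchE; case: ifPn => [|_]; last first.
  by rewrite mulr0 divr_ge0 ?powR_ge0.
rewrite inE /eball/= subr0 => xyr; rewrite mulrC ler_wpM2l//.
rewrite lef_pV2 ?posrE ?powR_gt0//; last by rewrite ltr_wpDl ?enorm_ge0.
apply: ge0_ler_powR.
- by rewrite subr_ge0 ltW.
- by rewrite nnegrE enorm_ge0.
- by rewrite nnegrE addr_ge0 ?enorm_ge0// ltW.
have -> : y = x - (x - y) by rewrite subKr.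
by rewrite (le_trans (ler_enormB _ _))// lerD2l ltW.
Qed.

Lemma ae_reflect (P : 'rV[R]_n -> Prop) x :
  {ae leb, forall y, P y} -> {ae leb, forall y, P (x - y)}.
Proof.
move=> [N [mN N0 PN]]; exists ((fun y => x - y) @^-1` N); split.
- by rewrite -[X in measurable X]setTI; exact: measurable_reflect.
- by rewrite [LHS]lebesgue_rV_reflect.
- by move=> y /= Py; apply: PN.
Qed.

Lemma riesz_const_ge0 (s : R) : 0 <= riesz_const n s.
Proof.
by rewrite /riesz_const !mulr_ge0 ?powR_ge0 ?invr_ge0 ?Gamma_ge0.
Qed.

Lemma riesz_potential_ge (s : R) (f : 'rV[R]_n -> R) x (r : R) :
  (0 < n)%N -> s < n%:R -> 0 < r -> measurable_fun [set: rVleb] f ->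
  {ae leb, forall y, 0 <= f y} ->
  ((riesz_const n s)%:E * (((enorm x + r) `^ (n%:R - s))^-1%:E *
     \int[leb]_(y in eball 0 r) `|(f y)%:E|) <= riesz_potential s f x)%E.
Proof.
move=> n0 sn r0 mf f0; rewrite /riesz_potential lee_wpmul2l ?lee_fin ?riesz_const_ge0//.
have mnf : measurable_fun [set: rVleb] (fun y => `|f y|) by exact: measurableT_comp.
have -> : (\int[leb]_y (f (x - y) / enorm y `^ (n%:R - s))%:E =
    \int[leb]_y (`|f (x - y)| / enorm y `^ (n%:R - s))%:E)%E.
  apply: ae_eq_integral.
  - exact: measurableT.
  - by apply/measurable_EFinP; exact: measurable_riesz_integrand.
  - by apply/measurable_EFinP; exact: (@measurable_riesz_integrand s (fun y => `|f y|)).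
  - have [N [mN N0 PN]] := @ae_reflect _ x f0; exists N; split => // y /= Py.
    by apply: PN => /= fy; apply: Py => _; rewrite ger0_norm.
exact: (@ge0_riesz_integral_ge s (fun y => `|f y|)).
Qed.

End riesz_lower_bound.

Section weak_norm.
Context {R : realType} {n : nat}.
Local Notation leb := (lebesgue_rV R n).
Local Notation rVleb := (caratheodory_type (product_lebesgue R n)^*%mu).
Local Open Scope ereal_scope.

Lemma measurable_norm_integrable (f : 'rV[R]_n -> R) :
  leb.-integrable setT (EFin \o f) ->
  measurable_fun [set: rVleb] (fun y => `|(f y)%:E|).
Proof.
move=> /integrableP[/measurable_EFinP mf _].
have mnf : measurable_fun [set: rVleb] (fun y => `|f y|%R).
  exact: (measurableT_comp (@normr_measurable R setT) mf).
exact: (iffRL (measurable_EFinP _ _) mnf).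
Qed.

Lemma weak_Lnorm_ge0 (p : R) (g : 'rV[R]_n -> \bar R) : 0 <= weak_Lnorm p g.
Proof.
apply: le_trans (ereal_sup_ubound _); last by exists 1%R => //=; exact: ltr01.
by rewrite mul1e poweR_ge0.
Qed.

(** Off the measurable sets lebesgue_rV is the outer measure, so it is monotone on
superlevel sets that are not known to be measurable. *)
Lemma weak_Lnorm_ge_level (p l : R) (A : set 'rV[R]_n) (g : 'rV[R]_n -> \bar R) :
  (0 < p)%R -> (0 < l)%R -> A `<=` [set x | l%:E < `|g x|] ->
  l%:E * leb A `^ p^-1 <= weak_Lnorm p g.
Proof.
move=> p0 l0 Ag; apply: le_trans (ereal_sup_ubound _); last by exists l.
rewrite lee_wpmul2l ?lee_fin ?(ltW l0)//.
apply: gt0_ler_poweR.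
- by rewrite invr_ge0 ltW.
- by rewrite in_itv/= leey andbT measure_ge0.
- by rewrite in_itv/= leey andbT measure_ge0.
- exact: le_lebesgue_rV.
Qed.

(** The level gamma_s m rho^(s - n), with m the mass of f in the ball of radius r,
is exceeded on the ball of radius rho - r. The factor t < 1 is the loss
((rho - r) / rho)^(n - s). *)
Lemma weak_Lnorm_truncated_ge (s : R) (f : 'rV[R]_n -> R) (r t : R) :
  (0 < s)%R -> (s < n%:R)%R -> (0 < r)%R -> (0 < t < 1)%R ->
  leb.-integrable setT (EFin \o f) -> {ae leb, forall y, (0 <= f y)%R} ->
  ((riesz_const n s)%:E * t%:E) * unit_ball_volume R n `^ ((n%:R - s) / n%:R) *
    \int[leb]_(y in eball 0 r) `|(f y)%:E|
  <= weak_Lnorm (n%:R / (n%:R - s)) (riesz_potential s f).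
Proof.
move=> s0 sn r0 /andP[t0 t1] If f0.
have n0 : (0 < n%:R :> R)%R by exact: lt_trans s0 sn.
have ns0 : (0 < n%:R - s)%R by rewrite subr_gt0.
set M := \int[leb]_(y in _) _.
have mB : measurable (eball 0 r : set rVleb).
  by apply: measurable_rVleb; exact: measurable_eball.
have mf : measurable_fun [set: rVleb] f.
  by have /integrableP[/measurable_EFinP] := If.
have M0 : 0 <= M by apply: integral_ge0 => y _; exact: abse_ge0.
have Mfin : M \is a fin_num.
  rewrite ge0_fin_numE//.
  have /integrableP[_] := If; apply: le_lt_trans.
  apply: ge0_subset_integral => [|||y _|].
  - exact: mB.
  - exact: measurableT.
  - exact: measurable_norm_integrable.
  - exact: abse_ge0.
  - exact: subsetT.
rewrite -(fineK Mfin); set m := fine M.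
have m0 : (0 <= m)%R by exact: fine_ge0.
have := riesz_const_ge0 (n := n) s; rewrite le_eqVlt => /predU1P[<-|g0].
  by rewrite !mul0e weak_Lnorm_ge0.
move: m0; rewrite le_eqVlt => /predU1P[<-|m0].
  by rewrite mule0 weak_Lnorm_ge0.
set g := riesz_const n s in g0 *.
pose q := (n%:R - s)%R.
(* rho is chosen so that ((rho - r) / rho) ^ q = t. *)
pose th := (t `^ q^-1)%R.
have th0 : (0 < th)%R by exact: powR_gt0.
have th1 : (th < 1)%R.
  apply: (@lt_le_trans _ _ (1 `^ q^-1)%R); last by rewrite powR1.
  by apply: gt0_ltr_powR; rewrite ?invr_gt0 ?nnegrE// ltW.
pose rho := (r / (1 - th))%R.
have th1' : (0 < 1 - th)%R by rewrite subr_gt0.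
have rho0 : (0 < rho)%R by rewrite divr_gt0.
have rhor : (rho - r = th * rho)%R.
  by rewrite /rho; field; rewrite gt_eqF.
pose l := (g * m * rho `^ (- q))%R.
have l0 : (0 < l)%R by apply: mulr_gt0; [exact: mulr_gt0|exact: powR_gt0].
apply: le_trans (@weak_Lnorm_ge_level _ l (eball 0 (rho - r)) _ _ l0 _); last 2 first.
- by rewrite divr_gt0.
- move=> x; rewrite /eball/= subr0 => xr.
  apply: lt_le_trans (lee_abs _).
  apply: lt_le_trans (riesz_potential_ge x _ sn r0 mf f0); last by rewrite -(ltr0n R).
  rewrite (_ : integral _ _ _ = m%:E); last by rewrite fineK.
  rewrite -/g -!EFinM lte_fin /l -mulrA ltr_pM2l// mulrC ltr_pM2r//.
  rewrite powRN ltf_pV2 ?posrE ?powR_gt0//; last by rewrite ltr_wpDl ?enorm_ge0.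
  apply: gt0_ltr_powR => //.
  + by rewrite nnegrE addr_ge0 ?enorm_ge0 ?ltW.
  + by rewrite nnegrE ltW.
  + by rewrite -ltrBrDr.
have thrho0 : (0 < th * rho)%R by exact: mulr_gt0.
rewrite rhor lebesgue_eball// poweRM ?unit_ball_volume_ge0 ?lee_fin ?exprn_ge0 ?(ltW thrho0)//.
rewrite invf_div -/q poweR_EFin muleA -EFinM.
rewrite -!EFinM muleAC -EFinM le_eqVlt; apply/orP; left; apply/eqP.
congr (_%:E * _).
rewrite -powR_mulrn ?(ltW thrho0)// -powRrM.
rewrite (_ : n%:R * (q / n%:R) = q)%R; last by field; rewrite gt_eqF.
rewrite powRM ?(ltW th0) ?(ltW rho0)// /th -powRrM mulVf ?gt_eqF// powRr1 ?(ltW t0)// /l.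
rewrite powRN; field.
by rewrite gt_eqF// powR_gt0.
Qed.

(** Let t tend to 1 and r tend to infinity in [weak_Lnorm_truncated_ge]. *)
Lemma weak_Lnorm_riesz_ge (s : R) (f : 'rV[R]_n -> R) :
  (0 < s)%R -> (s < n%:R)%R ->
  leb.-integrable setT (EFin \o f) -> {ae leb, forall y, (0 <= f y)%R} ->
  (riesz_const n s)%:E * unit_ball_volume R n `^ ((n%:R - s) / n%:R)
    * 'N[leb]_1 [EFin \o f]
  <= weak_Lnorm (n%:R / (n%:R - s)) (riesz_potential s f).
Proof.
move=> s0 sn If f0; rewrite Lnorm1.
apply/lee_mul01Pr.
  rewrite !mule_ge0 ?lee_fin ?riesz_const_ge0 ?poweR_ge0//.
  by apply: integral_ge0 => y _; exact: abse_ge0.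
move=> t t01; set W := weak_Lnorm _ _.
pose F k := (eball 0 k.+1%:R : set rVleb).
pose K := (riesz_const n s)%:E * t%:E * unit_ball_volume R n `^ ((n%:R - s) / n%:R).
have Kfin : K \is a fin_num.
  by rewrite !fin_numM// fin_num_poweR// unit_ball_volume_fin.
have cvgF : (fun k => K * \int[leb]_(y in F k) `|(f y)%:E|) @ \oo -->
    K * \int[leb]_y `|(f y)%:E|.
  apply: cvgeZl => //.
  have <- : \bigcup_k F k = setT.
    apply/seteqP; split => // y _; exists (Num.truncn (enorm y)) => //.
    by rewrite /F /eball/= subr0 truncnS_gt.
  apply: ge0_nondecreasing_set_cvg_integral.
  - apply/nondecreasing_seqP => k; rewrite subsetEset => y; rewrite /F /eball/=.
    by move/lt_trans; apply; rewrite ltr_nat.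
  - by move=> k; apply: measurable_rVleb; exact: measurable_eball.
  - by move=> k; apply: measurable_funTS; exact: measurable_norm_integrable.
  - by move=> k y _; exact: abse_ge0.
apply: (@le_trans _ _ (K * \int[leb]_y `|(f y)%:E|)).
  by rewrite /K !muleA (muleC t%:E).
rewrite -(cvg_lim _ cvgF)//; apply: lime_le; first by apply/cvg_ex; eexists; exact: cvgF.
apply: nearW => k; exact: weak_Lnorm_truncated_ge.
Qed.

(** The hypothesis says that |g| is below m |x - x0|^-q, written without a division
so that it makes sense at x = x0. The level l is exceeded at most on the ball
of radius (m / l)^(1 / q), whose measure compensates l exactly. *)
Lemma weak_Lnorm_le_inverse_power (q m : R) (x0 : 'rV[R]_n) (g : 'rV[R]_n -> \bar R) :
  (0 < q)%R -> (0 < n)%N -> (0 <= m)%R ->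
  (forall x l, (0 < l)%R -> l%:E < `|g x| -> (l * enorm (x - x0) `^ q < m)%R) ->
  weak_Lnorm (n%:R / q) g <= m%:E * unit_ball_volume R n `^ (q / n%:R).
Proof.
move=> q0 n0 m0 gm; apply: ge_ereal_sup => _ [l /= l0 <-].
rewrite invf_div.
have n0' : (0 < n%:R :> R)%R by rewrite ltr0n.
have [mE|m_neq0] := eqVneq m 0%R.
  rewrite (_ : [set _ | _] = set0).
    by rewrite measure0 poweR0r ?mule0 ?mE ?mul0e// gt_eqF// divr_gt0.
  apply/seteqP; split => // x /= /(gm _ _ l0); rewrite mE ltNge.
  by rewrite mulr_ge0 ?powR_ge0// ltW.
have {m0 m_neq0} m0 : (0 < m)%R by rewrite lt_neqAle eq_sym m_neq0.
pose rho := ((m / l) `^ q^-1)%R.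
have ml0 : (0 < m / l)%R by rewrite divr_gt0.
have rho0 : (0 < rho)%R by exact: powR_gt0.
have rhoq : (rho `^ q = m / l)%R.
  by rewrite /rho -powRrM mulVf ?gt_eqF// powRr1// ltW.
have sub : [set x | l%:E < `|g x|] `<=` eball x0 rho.
  move=> x /= /(gm _ _ l0) lx; rewrite /eball/= ltNge; apply/negP => rx.
  move: lx; rewrite ltNge => /negP; apply.
  rewrite -ler_pdivrMl// mulrC -rhoq; apply: ge0_ler_powR => //.
  - exact: ltW.
  - by rewrite nnegrE ltW.
  - by rewrite nnegrE enorm_ge0.
apply: (@le_trans _ _ (l%:E * leb (eball x0 rho) `^ (q / n%:R))).
  rewrite lee_wpmul2l ?lee_fin ?(ltW l0)//; apply: gt0_ler_poweR.
  - by rewrite divr_ge0 ?ltW.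
  - by rewrite in_itv/= leey andbT measure_ge0.
  - by rewrite in_itv/= leey andbT measure_ge0.
  - exact: le_lebesgue_rV.
rewrite lebesgue_eball// poweRM ?unit_ball_volume_ge0 ?lee_fin ?exprn_ge0 ?(ltW rho0)//.
rewrite poweR_EFin muleA -EFinM le_eqVlt; apply/orP; left; apply/eqP.
congr (_%:E * _).
rewrite -powR_mulrn ?(ltW rho0)// -powRrM.
rewrite (_ : n%:R * (q / n%:R) = q)%R; last by field; rewrite gt_eqF.
by rewrite rhoq; field; rewrite gt_eqF.
Qed.

End weak_norm.

(** * Equality for bubbles *)

Section bubble_extremal.
Context {R : realType} {n : nat}.
Local Notation leb := (lebesgue_rV R n).
Local Notation mu := (product_lebesgue R n).

Variables (s a b : R) (x0 : 'rV[R]_n) (f : 'rV[R]_n -> R).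
Hypotheses (s_gt0 : 0 < s) (s_ltn : s < n%:R) (a_gt0 : 0 < a) (b_gt0 : 0 < b).
Hypothesis fE : forall x, f x = (a / (b + enorm (x - x0) ^+ 2)) `^ ((n%:R + s) / 2).

Let ca : R := a `^ ((n%:R + s) / 2).

Lemma bubbleE x : f x = ca * (b + enorm (x0 - x) ^+ 2) `^ (- ((n%:R + s) / 2)).
Proof.
have d0 : 0 < b + enorm (x0 - x) ^+ 2 by rewrite ltr_pwDl// sqr_ge0.
rewrite fE -opprB enormN powRM ?invr_ge0 ?(ltW a_gt0) ?(ltW d0)//; congr (_ * _).
by rewrite -powR_inv1 ?(ltW d0)// -powRrM mulN1r.
Qed.

Lemma bubble_ge0 x : 0 <= f x. Proof. by rewrite fE powR_ge0. Qed.

Let measurable_kernel x : measurable_fun [set: 'rV[R]_n]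
  (fun y => (b + enorm (x - y) ^+ 2) `^ (- ((n%:R + s) / 2))).
Proof.
apply: (measurableT_comp (@measurable_powR R _)); apply: measurable_funD => //.
by apply: measurable_funX; exact: measurable_enormB.
Qed.

Lemma measurable_bubble : measurable_fun [set: 'rV[R]_n] f.
Proof.
rewrite (_ : f = fun x => ca * (b + enorm (x0 - x) ^+ 2) `^ (- ((n%:R + s) / 2))).
  exact: measurable_funM.
by apply/funext => x; exact: bubbleE.
Qed.

Lemma integral_bubbleE :
  (\int[leb]_x `|(f x)%:E| = (ca * bubble_mass n s b)%:E)%E.
Proof.
under eq_integral => x _ do rewrite gee0_abs ?lee_fin ?bubble_ge0//.
rewrite ge0_integral_lebesgue_rV; last 2 first.
- by apply/measurable_EFinP; exact: measurable_bubble.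
- by move=> x; rewrite lee_fin bubble_ge0.
rewrite EFinM -(integral_bubble x0 s_gt0 b_gt0) -ge0_integralZl_EFin.
- by apply: eq_integral => x _; rewrite bubbleE.
- exact: measurableT.
- by move=> x _; rewrite lee_fin powR_ge0.
- exact/measurable_EFinP.
- exact: powR_ge0.
Qed.

Lemma integrable_bubble : leb.-integrable setT (EFin \o f).
Proof.
apply/integrableP; split.
  by apply/measurable_EFinP; apply: measurable_fun_rVleb; exact: measurable_bubble.
by rewrite [ltLHS]integral_bubbleE ltry.
Qed.

Lemma riesz_potential_bubble_le x :
  (`|riesz_potential s f x| <= (riesz_const n s * (ca * bubble_mass n s b) *
     (b + enorm (x - x0) ^+ 2) `^ (- ((n%:R - s) / 2)))%:E)%E.
Proof.
have g0 := riesz_const_ge0 (n := n) s.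
pose k := riesz_bubble ((n%:R + s) / 2) (n%:R - s) b (x - x0).
have fyE y : f (x - y) / enorm y `^ (n%:R - s) = ca * k y.
  rewrite bubbleE /k /riesz_bubble mulrA -opprB enormN.
  by rewrite (_ : x - y - x0 = x - x0 - y)// addrAC.
rewrite gee0_abs; last first.
  rewrite mule_ge0 ?lee_fin//; apply: integral_ge0 => y _.
  by rewrite fyE lee_fin mulr_ge0 ?powR_ge0 ?riesz_bubble_ge0.
rewrite /riesz_potential -mulrA [leRHS]EFinM lee_wpmul2l ?lee_fin//.
under eq_integral => y _ do rewrite fyE.
rewrite ge0_integral_lebesgue_rV; last 2 first.
- apply/measurable_EFinP; apply: measurable_funM => //.
  exact: measurable_riesz_bubble.
- by move=> y; rewrite lee_fin mulr_ge0 ?powR_ge0 ?riesz_bubble_ge0.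
under eq_integral do rewrite EFinM.
rewrite ge0_integralZl_EFin.
- rewrite -mulrA EFinM lee_wpmul2l ?lee_fin ?powR_ge0//.
  exact: integral_riesz_bubble_le.
- exact: measurableT.
- by move=> y _; rewrite lee_fin riesz_bubble_ge0.
- by apply/measurable_EFinP; exact: measurable_riesz_bubble.
- exact: powR_ge0.
Qed.

Lemma weak_Lnorm_riesz_bubble :
  (weak_Lnorm (n%:R / (n%:R - s)) (riesz_potential s f)
   = (riesz_const n s)%:E * unit_ball_volume R n `^ ((n%:R - s) / n%:R)
     * 'N[leb]_1 [EFin \o f])%E.
Proof.
have q0 : 0 < n%:R - s by rewrite subr_gt0.
have n0 : (0 < n)%N by rewrite -(ltr0n R) (lt_trans s_gt0).
have g0 := riesz_const_ge0 (n := n) s.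
apply/eqP; rewrite eq_le; apply/andP; split; last first.
  apply: weak_Lnorm_riesz_ge => //; first exact: integrable_bubble.
  exists set0; split; [exact: measurable0|by rewrite measure0|].
  by move=> x /=; apply: contra_notP => _; exact: bubble_ge0.
rewrite Lnorm1 [X in (_ <= _ * X)%E]integral_bubbleE muleAC -EFinM.
apply: (@weak_Lnorm_le_inverse_power _ _ _ _ x0) => //.
  by rewrite mulr_ge0// mulr_ge0 ?bubble_mass_ge0// powR_ge0.
move=> x l l0 /lt_le_trans/(_ (riesz_potential_bubble_le x)); rewrite lte_fin powRN.
have d0 : 0 < b + enorm (x - x0) ^+ 2 by rewrite ltr_pwDl// sqr_ge0.
rewrite ltr_pdivlMr ?powR_gt0//; apply: le_lt_trans.
rewrite ler_wpM2l ?(ltW l0)//.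
have -> : enorm (x - x0) `^ (n%:R - s) = (enorm (x - x0) ^+ 2) `^ ((n%:R - s) / 2).
  rewrite -powR_mulrn ?enorm_ge0// -powRrM; congr (_ `^ _); by field.
apply: ge0_ler_powR.
- by rewrite divr_ge0 ?ltW.
- by rewrite nnegrE sqr_ge0.
- by rewrite nnegrE ltW.
- by rewrite lerDr ltW.
Qed.

End bubble_extremal.

Theorem theorem1p2 (R : realType) (n : nat) (s : R)
    (hs : 0 < s) (hsn : s < n%:R) :
  (forall f : 'rV[R]_n -> R,
     (lebesgue_rV R n).-integrable setT (EFin \o f) ->
     {ae lebesgue_rV R n, forall x, 0 < f x} ->
     ((riesz_const n s)%:E
        * unit_ball_volume R n `^ ((n%:R - s) / n%:R)
        * 'N[lebesgue_rV R n]_1 [EFin \o f]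
      <= weak_Lnorm (n%:R / (n%:R - s)) (riesz_potential s f))%E)
  /\
  (forall (a b : R) (x0 : 'rV[R]_n) (f : 'rV[R]_n -> R),
     0 < a -> 0 < b ->
     (forall x, f x = (a / (b + enorm (x - x0) ^+ 2)) `^ ((n%:R + s) / 2)) ->
     (weak_Lnorm (n%:R / (n%:R - s)) (riesz_potential s f)
      = (riesz_const n s)%:E
        * unit_ball_volume R n `^ ((n%:R - s) / n%:R)
        * 'N[lebesgue_rV R n]_1 [EFin \o f])%E).
Proof.
split=> [f If f_gt0|a b x0 f a0 b0 fE]; last exact: weak_Lnorm_riesz_bubble fE.
apply: weak_Lnorm_riesz_ge => //.
have [N [mN N0 fN]] := f_gt0; exists N; split=> // x /= nfx; apply: fN => /= fx.
by apply: nfx; exact: ltW.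
Qed.
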